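(* Let $\mathbf Y=\mathbf H(z,\mathbf Y)$ be an irreducible system of dimension $m$, with generating function solution $\mathbf Y$ of radius of convergence $\rho$. Let $(a,\mathbf B)\in\mathbb R_{\ge0}^{m+1}$ belong to the domain of convergence of $\mathbf H$ or its boundary and satisfy $\mathbf B=\mathbf H(a,\mathbf B)$. Then $\rho>0$ and: (1) if $\mathbf H$ is linear in the variables $\mathbf Y$, then $a\le\rho$ and $\mathbf B=\mathbf Y(a)$; (2) in all cases, (a) $\Lambda_{\mathbf H}(a,\mathbf B)\le1$ if and only if ($a\le\rho$ and $\mathbf B=\mathbf Y(a)$); (b) if $\Lambda_{\mathbf H}(a,\mathbf B)=1$ then $(a,\mathbf B)=(\rho,\mathbf Y(\rho))$.
   Context: Let $\mathbf H=(H_1,\dots,H_m)$, written $\mathbf H(z,\mathbf Y)$, be analytic in a neighborhood of $\mathbf 0\in\mathbb C^{m+1}$; its domain of convergence is that of its Taylor series at $\mathbf 0$. The system $\mathbf Y=\mathbf H(z,\mathbf Y)$ is well founded when (i) each $H_i$ has nonnegative real Taylor coefficients at $\mathbf 0$; (ii) with $\mathbf U^{[0]}=\mathbf 0$, for $k=0,\dots,m$, $(0,\mathbf U^{[k]})$ lies in the domain of convergence, so that $\mathbf U^{[k+1]}=\mathbf H(0,\mathbf U^{[k]})$ is defined; (iii) $\partial\mathbf H/\partial\mathbf Y$ at $(0,\mathbf U^{[m]})$ is nilpotent. The generating function solution is the unique solution analytic near $0$ with value $\mathbf U^{[m]}$ at $0$ (nonnegative Taylor coefficients); $\mathbf Y(\rho)$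 denotes its limit as $z\to\rho^-$. The system is recursive if $\partial\mathbf H/\partial\mathbf Y$ (as a matrix of functions) is not nilpotent, zero-free if no coordinate of the solution is identically zero, and irreducible if it is well founded, zero-free, recursive and its dependency graph (vertices $1,\dots,m$, edge $i\to j$ when $H_i$ depends on $Y_j$) is strongly connected. $\Lambda_{\mathbf H}(x,\mathbf y)$ denotes the spectral radius of $\partial\mathbf H/\partial\mathbf Y(x,\mathbf y)$ (for nonnegative real arguments, its largest real eigenvalue). *)

(* Defs.v *)
(* C is R[i]; its topology is that of the normed space (R[i])^o. *)
From HB Require Import structures.
From mathcomp Require Import all_boot all_order all_algebra finmap complex.
From mathcomp Require Import all_classical all_reals all_analysis.
From mathcomp Require analysis.showcase.summability.

Set Implicit Arguments.
Unset Strict Implicit.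
Unset Printing Implicit Defensive.

Import Order.TTheory GRing.Theory Num.Theory.
Import numFieldNormedType.Exports.

Local Open Scope classical_set_scope.
Local Open Scope ring_scope.
Local Open Scope complex_scope.

Section families.
Variables (R : realType) (I : choiceType).

Definition cmodulus (z : R[i]) : R := complex.Re `|z|.

Definition abs_summable (f : I -> R[i]) : Prop :=
  summable setT (fun n => (cmodulus (f n))%:E).

(* Unordered sum, i.e., the limit of the sums over finite sets of indices;
   meaningful when [abs_summable f] holds. *)
Definition csum (f : I -> R[i]) : R[i] :=
  @summability.sum I R[i] (R[i])^o f.

End families.

Section systems.
Variables (R : realType) (m : nat).

(* The exponents (n, k) of z ^ n * Y_1 ^ k_1 * ... * Y_m ^ k_m. *)
Definition mindex := (nat * {ffun 'I_m -> nat})%type.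

(* H = (H_1, ..., H_m), analytic at 0, is given by the Taylor coefficients at 0
   of its coordinates. *)
Definition system := 'I_m -> mindex -> R[i].

Definition cpoint := ((R[i])^o * 'rV[(R[i])^o]_m)%type.

Definition ps_monomial (p : cpoint) (n : mindex) : R[i] :=
  p.1 ^+ n.1 * \prod_(j < m) p.2 0 j ^+ n.2 j.

Definition ps_term (c : mindex -> R[i]) (p : cpoint) (n : mindex) : R[i] :=
  c n * ps_monomial p n.

Definition domain_of_convergence (H : system) : set cpoint :=
  interior [set p : cpoint | forall i, abs_summable (ps_term (H i) p)].

Definition sys_eval (H : system) (p : cpoint) : 'rV[(R[i])^o]_m :=
  \row_i csum (ps_term (H i) p).

(* Taylor coefficients of the partial derivative with respect to Y_j. *)
Definition ps_dY (j : 'I_m) (c : mindex -> R[i]) (n : mindex) : R[i] :=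
  (n.2 j).+1%:R * c (n.1, [ffun l => (n.2 l + (l == j))%N]).

Definition jacobian (H : system) (p : cpoint) : 'M[R[i]]_m :=
  \matrix_(i, j) csum (ps_term (ps_dY j (H i)) p).

Definition nilpotent_mx (M : 'M[R[i]]_m) : Prop := exists k : nat, M ^+ k = 0.

Fixpoint Uiter (H : system) (k : nat) : 'rV[(R[i])^o]_m :=
  if k is k'.+1 then sys_eval H (0, Uiter H k') else 0.

(* In the order of R[i], 0 <= z means that z is a nonnegative real. *)
Definition well_founded_system (H : system) : Prop :=
  [/\ forall i n, 0 <= H i n,
      forall k, (k <= m)%N -> domain_of_convergence H (0, Uiter H k)
    & nilpotent_mx (jacobian H (0, Uiter H m))].

(* Univariate power series y_1, ..., y_m, given by their coefficients. *)
Definition gf := 'I_m -> nat -> R[i].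

Definition gf_term (y : gf) (z : R[i]) (i : 'I_m) (n : nat) : R[i] :=
  y i n * z ^+ n.

Definition gf_eval (y : gf) (z : R[i]) : 'rV[(R[i])^o]_m :=
  \row_i csum (gf_term y z i).

Definition gf_solution (H : system) (y : gf) : Prop :=
  [/\ forall i n, 0 <= y i n,
      forall i, y i 0%N = Uiter H m 0 i
    & \forall z \near (0 : (R[i])^o),
        [/\ forall i, abs_summable (gf_term y z i),
            domain_of_convergence H (z, gf_eval y z)
          & gf_eval y z = sys_eval H (z, gf_eval y z)]].

(* The least of the radii of convergence of the coordinates. *)
Definition gf_radius (y : gf) : \bar R :=
  ereal_sup [set r%:E | r in
    [set r : R | 0 <= r /\ forall i, abs_summable (gf_term y r%:C i)]].

(* B = Y(a), for 0 <= a <= gf_radius y: the sum of the series inside the disk of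
   convergence, and the limit from the left at a = gf_radius y. *)
Definition gf_value (y : gf) (a : R) (B : 'rV[R]_m) : Prop :=
  if (a%:E < gf_radius y)%E
  then forall i, gf_eval y a%:C 0 i = (B 0 i)%:C
  else forall i, complex.Re (gf_eval y x%:C 0 i) @[x --> a^'-] --> B 0 i.

Definition recursive_system (H : system) : Prop :=
  ~ exists k : nat, forall p, domain_of_convergence H p ->
      jacobian H p ^+ k = 0.

Definition zero_free (H : system) : Prop :=
  forall y, gf_solution H y -> forall i, exists n, y i n != 0.

Definition depends (H : system) (i j : 'I_m) : Prop :=
  exists n : mindex, (0 < n.2 j)%N /\ H i n != 0.

Definition strongly_connected (H : system) : Prop :=
  forall i j, connect [rel u v | `[< depends H u v >]] i j.

Definition irreducible_system (H : system) : Prop :=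
  [/\ well_founded_system H, zero_free H, recursive_system H
    & strongly_connected H].

(* Degree at most 1 in Y: terms free of Y are allowed. *)
Definition linear_in_Y (H : system) : Prop :=
  forall i (n : mindex), (1 < \sum_(j < m) n.2 j)%N -> H i n = 0.

Definition real_point (a : R) (B : 'rV[R]_m) : cpoint :=
  (a%:C, \row_i (B 0 i)%:C).

(* B = H(a, B): the series converge at (a, B), possibly on the boundary of the
   domain of convergence, and their sums are the coordinates of B. *)
Definition fixed_at (H : system) (a : R) (B : 'rV[R]_m) : Prop :=
  forall i, abs_summable (ps_term (H i) (real_point a B)) /\
    sys_eval H (real_point a B) 0 i = (B 0 i)%:C.

Definition spectral_radius (M : 'M[R[i]]_m) : R :=
  sup [set cmodulus l | l in [set l : R[i] | eigenvalue M l]].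

(* On the boundary of the domain of convergence, a (nonnegative) series for an
   entry of the Jacobian matrix may diverge to +oo; Lambda is then +oo. *)
Definition Lambda (H : system) (a : R) (B : 'rV[R]_m) : \bar R :=
  if `[< forall i j, abs_summable (ps_term (ps_dY j (H i)) (real_point a B)) >]
  then (spectral_radius (jacobian H (real_point a B)))%:E
  else +oo%E.

End systems.

(* Main.v *)
(* Let F_k be finite sets of exponents exhausting all of them, and let approx k
   be the polynomials obtained from 0 by iterating the truncation of H to F_k.
   Their coefficients increase with k, approx k (a) <= B at every fixed point
   (a, B), and the limit of approx k (a), when it is finite, is a fixed point.
   For small a > 0 the Jacobian matrix at (a, Y(a)) contracts a positive vector,
   because it is nilpotent at a = 0; so the limit is Y(a), and the coefficients
   of approx k tend to those of Y.  Hence, for every fixed point (a, B), Y(a)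
   converges, is a fixed point, and Y(a) <= B.

   The rest compares two fixed points by convexity: along a segment every
   monomial is a polynomial with nonnegative coefficients, so a difference of
   values of H lies between the tangent maps at both ends.  With d = B - Y(a)
   this gives d <= J(a, B) d, which with irreducibility forces d = 0 when no
   eigenvalue exceeds 1; with v = Y(b) - Y(a), a < b, it gives J(a, Y(a)) v <= v,
   which bounds the spectral radius at (a, Y(a)) by 1, strictly when a < rho. *)
Require Import Defs.
From HB Require Import structures.
From mathcomp Require Import all_boot all_order all_algebra finmap complex.
From mathcomp Require Import all_classical all_reals all_analysis.
From mathcomp Require Import ring lra.

Set Implicit Arguments.
Unset Strict Implicit.
Unset Printing Implicit Defensive.

Import Order.TTheory GRing.Theory Num.Theory.
Import numFieldNormedType.Exports.

Local Open Scope classical_set_scope.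
Local Open Scope ring_scope.

(** * Sums of nonnegative families *)

Section nonneg_sums.
Variables (R : realType) (I : choiceType).
Implicit Types (f g : I -> R) (s t : R) (F G : {fset I}).

(** As all coefficients are nonnegative, every series is handled instead as a supremum of finite
    sums, and every estimate is made monomial by monomial. Truncating [H] makes the iterates
    polynomials in z. The same polynomials are compared with Y near 0, the only place where Y is
    given as a solution, and with B at a; this carries information from 0 to a. No eigenvector is
    constructed. A bound on the spectrum enters as invertibility of t - J for all t > 1, and is
    obtained from positive vectors w with J w <= t w. The case a = 0 needs arguments of its own:
    Y(0) may have zero coordinates, so strong connectivity gives no positivity, and nilpotency of
    the Jacobian at (0, Y(0)) takes its place. *)

Definition psum f F : R := \sum_(n <- F) f n.

(** For nonnegative [f] this is the unordered sum. Convergence and value form a single relation,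
    whose two halves serve as inequalities. *)
Definition has_nsum f s : Prop :=
  (forall F, psum f F <= s) /\ (forall M, (forall F, psum f F <= M) -> s <= M).

Lemma has_nsum_ex f M : (forall F, psum f F <= M) -> exists s, has_nsum f s.
Proof.
move=> fM.
have hs : has_sup (range (psum f)).
  split; first by exists (psum f fset0); exists fset0.
  by exists M => _ [F _ <-].
exists (sup (range (psum f))); split => [F|M' fM'].
  by apply: sup_upper_bound => //; exists F.
apply: ge_sup; first exact: hs.1.
by move=> _ [F _ <-].
Qed.

Lemma has_nsum_uniq f s t : has_nsum f s -> has_nsum f t -> s = t.
Proof.
move=> [fs sm] [ft tm]; apply/eqP; rewrite eq_le.
by rewrite sm//= tm.
Qed.

Lemma has_nsum_ext f g s : f =1 g -> has_nsum f s -> has_nsum g s.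
Proof. by move=> /funext ->. Qed.

Lemma has_nsum_approx f s e : has_nsum f s -> 0 < e ->
  exists F, s - e < psum f F.
Proof.
move=> [fs sm] e0; apply: contrapT => /forallNP nF.
suff : s <= s - e by lra.
by apply: sm => F; move/negP: (nF F); rewrite -leNgt.
Qed.

Lemma has_nsum_ge0 f s : has_nsum f s -> 0 <= s.
Proof. by move=> [fs _]; have := fs fset0; rewrite /psum big_seq_fset0. Qed.

Lemma psum_le f g F : (forall n, f n <= g n) -> psum f F <= psum g F.
Proof. by move=> fg; rewrite /psum ler_sum. Qed.

Lemma psum_sub f F G : (forall n, 0 <= f n) -> (F `<=` G)%fset ->
  psum f F <= psum f G.
Proof.
move=> f0 FG; rewrite /psum (big_fsetID _ (mem F) G) /=.
have -> : [fset x in G | x \in F]%fset = F.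
  by apply/fsetP => x; rewrite !inE /= andbC; case: (boolP (x \in F)) => //= /(fsubsetP FG).
by rewrite lerDl big_seq sumr_ge0.
Qed.

Lemma psumD f g F : psum (fun n => f n + g n) F = psum f F + psum g F.
Proof. by rewrite /psum big_split. Qed.

Lemma psumZ c f F : psum (fun n => c * f n) F = c * psum f F.
Proof. by rewrite /psum mulr_sumr. Qed.

Lemma psum1 f n : psum f [fset n]%fset = f n.
Proof. by rewrite /psum big_seq_fset1. Qed.

Lemma has_nsum_term f s n : has_nsum f s -> f n <= s.
Proof. by move=> [fs _]; have := fs [fset n]%fset; rewrite psum1. Qed.

Lemma has_nsum_le f g s t : (forall n, f n <= g n) ->
  has_nsum f s -> has_nsum g t -> s <= t.
Proof.
by move=> fg [_ sm] [gt _]; apply: sm => F; apply: le_trans (gt F); apply: psum_le.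
Qed.

Lemma has_nsum_dom f g t : (forall n, f n <= g n) -> has_nsum g t ->
  exists s, has_nsum f s.
Proof.
move=> fg [gt _]; apply: (@has_nsum_ex _ t) => F.
by apply: le_trans (gt F); apply: psum_le.
Qed.

Lemma has_nsum0 : has_nsum (fun=> 0) 0.
Proof.
split=> [F|M /(_ fset0)]; first by rewrite /psum big1.
by rewrite /psum big_seq_fset0.
Qed.

Lemma has_nsumD f g s t : (forall n, 0 <= f n) -> (forall n, 0 <= g n) ->
  has_nsum f s -> has_nsum g t -> has_nsum (fun n => f n + g n) (s + t).
Proof.
move=> f0 g0 hf hg; split=> [F|M fgM].
  by rewrite psumD lerD //; [apply: hf.1|apply: hg.1].
rewrite leNgt; apply/negP => lt.
pose e := (s + t - M) / 2%:R.
have e0 : 0 < e by rewrite /e; lra.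
have [F hF] := has_nsum_approx hf e0; have [G hG] := has_nsum_approx hg e0.
have := fgM (F `|` G)%fset; rewrite psumD.
have := @psum_sub f _ _ f0 (fsubsetUl F G).
have := @psum_sub g _ _ g0 (fsubsetUr F G).
by rewrite /e in hF hG; lra.
Qed.

Lemma has_nsumZ c f s : 0 <= c -> has_nsum f s -> has_nsum (fun n => c * f n) (c * s).
Proof.
rewrite le_eqVlt => /predU1P[<-|c0] [fs sm].
  by rewrite mul0r; apply: has_nsum_ext has_nsum0 => n; rewrite mul0r.
split=> [F|M cM]; first by rewrite psumZ ler_pM2l.
rewrite -ler_pdivlMl//; apply: sm => F.
by rewrite ler_pdivlMl// -psumZ.
Qed.

(** The surplus [g n - f n] is present in every finite sum whose index set contains [n], and adding
    [n] to an index set only increases a sum of [f]. *)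
Lemma has_nsum_lt f g s t n : (forall n, 0 <= f n) -> (forall n, f n <= g n) ->
  f n < g n -> has_nsum f s -> has_nsum g t -> s < t.
Proof.
move=> f0 fg lt hf hg; suff : s + (g n - f n) <= t by lra.
suff : s <= t - (g n - f n) by lra.
apply: hf.2 => F.
apply: (le_trans (psum_sub f0 (fsubsetUr [fset n]%fset F))).
have := hg.1 ([fset n] `|` F)%fset.
have nF : n \in ([fset n] `|` F)%fset by rewrite !inE eqxx.
have E k : psum k ([fset n] `|` F)%fset = k n + psum k (([fset n] `|` F) `\ n)%fset.
  by rewrite /psum (big_fsetD1 n nF).
rewrite !E; have := @psum_le f g (([fset n] `|` F) `\ n)%fset fg.
set u := psum f _; set v := psum g _; lra.
Qed.

Lemma has_nsum_lincomb (J : finType) (c : J -> R) (f : J -> I -> R) (s : J -> R) :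
  (forall j, 0 <= c j) -> (forall j n, 0 <= f j n) ->
  (forall j, has_nsum (f j) (s j)) ->
  has_nsum (fun n => \sum_j c j * f j n) (\sum_j c j * s j).
Proof.
move=> c0 f0 hs.
elim: (index_enum J) => [|j r IH].
  by rewrite big_nil; apply: has_nsum_ext has_nsum0 => n; rewrite big_nil.
rewrite big_cons; apply: (@has_nsum_ext (fun n => c j * f j n + \sum_(k <- r) c k * f k n)).
  by move=> n; rewrite big_cons.
apply: has_nsumD => //.
- by move=> n; rewrite mulr_ge0.
- by move=> n; rewrite sumr_ge0// => k _; rewrite mulr_ge0.
- exact: has_nsumZ.
Qed.

End nonneg_sums.

(** Serves to pass between two indexings of a derivative: by the exponent of the original monomial,
    and by the exponent left after differentiation. *)
Lemma has_nsum_reindex (R : realType) (I K : choiceType) (f : K -> R) (phi : I -> K) s :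
  injective phi -> (forall n, 0 <= f n) ->
  (forall n, f n != 0 -> exists k, n = phi k) ->
  has_nsum f s <-> has_nsum (f \o phi) s.
Proof.
move=> inj f0 im.
have bound M : (forall F, psum f F <= M) <-> (forall F, psum (f \o phi) F <= M).
  split=> fM F.
    have -> : psum (f \o phi) F = psum f (phi @` F)%fset.
      by rewrite /psum big_imfset //= => x y _ _; apply: inj.
    exact: fM.
  suff [G [_ ->]] : exists G, (forall k, k \in G -> phi k \in F) /\
      psum f F = psum (f \o phi) G by apply: fM.
  elim/finSet_rect: F => F IH.
  have [->|[n nF]] := fset_0Vmem F.
    by exists fset0; split => // ; rewrite /psum !big_seq_fset0.
  have [G [GF GE]] := IH (F `\ n)%fset (fproperD1 nF).
  have E : psum f F = f n + psum (f \o phi) G by rewrite -GE /psum (big_fsetD1 n nF).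
  have [fn0|/im[k nk]] := eqVneq (f n) 0.
    exists G; split; last by rewrite E fn0 add0r.
    by move=> k /GF; rewrite !inE => /andP[].
  have kG : k \notin G by apply/negP => /GF; rewrite nk !inE eqxx.
  exists (k |` G)%fset; split; last by rewrite E nk /psum big_fsetU1.
  move=> l; rewrite !inE => /predU1P[->|/GF]; first by rewrite -nk.
  by rewrite !inE => /andP[].
by split=> -[fs sm]; split=> [|M /bound /sm//]; exact/bound.
Qed.

(** * Nonnegative matrices *)

Section nonneg_matrices.
Variables (R : realType) (m : nat).
Implicit Types (A : 'M[R]_m) (d v w : 'I_m -> R) (c t : R).

Definition mxact A v (i : 'I_m) : R := \sum_j A i j * v j.

Definition nonneg_mx A := forall i j, 0 <= A i j.

Lemma mxact_le A v w : nonneg_mx A -> (forall i, v i <= w i) ->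
  forall i, mxact A v i <= mxact A w i.
Proof. by move=> A0 vw i; rewrite ler_sum// => j _; rewrite ler_wpM2l. Qed.

Lemma mxact_leM A A' v : (forall i, 0 <= v i) -> (forall i j, A i j <= A' i j) ->
  forall i, mxact A v i <= mxact A' v i.
Proof. by move=> v0 AA i; rewrite ler_sum// => j _; rewrite ler_wpM2r. Qed.

Lemma mxact_ge0 A v : nonneg_mx A -> (forall i, 0 <= v i) ->
  forall i, 0 <= mxact A v i.
Proof. by move=> A0 v0 i; rewrite sumr_ge0// => j _; rewrite mulr_ge0. Qed.

Lemma mxact_ge_term A v i j : nonneg_mx A -> (forall i, 0 <= v i) ->
  A i j * v j <= mxact A v i.
Proof.
move=> A0 v0; rewrite /mxact (bigD1 j)//= lerDl sumr_ge0// => k _.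
by rewrite mulr_ge0.
Qed.

Lemma mxactZ A c v i : mxact A (fun j => c * v j) i = c * mxact A v i.
Proof. by rewrite /mxact mulr_sumr; apply: eq_bigr => j _; rewrite mulrCA. Qed.

Lemma mxactB A v w i : mxact A (fun j => v j - w j) i = mxact A v i - mxact A w i.
Proof. by rewrite /mxact -sumrB; apply: eq_bigr => j _; rewrite mulrBr. Qed.

Lemma iter_mxact_ge0 A v k : nonneg_mx A -> (forall i, 0 <= v i) ->
  forall i, 0 <= iter k (mxact A) v i.
Proof. by move=> A0 v0; elim: k => //= k IH; apply: mxact_ge0. Qed.

Lemma iter_mxactE A v k i :
  iter k (mxact A) v i = mxact (A ^+ k) v i.
Proof.
elim: k i => [|k IH] i /=.
  rewrite expr0 /mxact (bigD1 i)//= mxE eqxx mul1r big1 ?addr0// => j ji.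
  by rewrite mxE eq_sym (negbTE ji) mul0r.
rewrite exprS /mxact; under eq_bigr => j _ do rewrite IH /mxact mulr_sumr.
rewrite exchange_big; apply: eq_bigr => j _.
by rewrite mxE mulr_suml; apply: eq_bigr => l _; rewrite mulrA.
Qed.

(** The least multiple of [w] above [d] touches [d] at some index. Inequalities evaluated at this
    contact index replace Perron-Frobenius theory. *)
Lemma max_ratio d w j : (forall i, 0 < w i) -> 0 < d j ->
  exists c i, [/\ 0 < c, d i = c * w i & forall k, d k <= c * w k].
Proof.
move=> w0 dj.
case: (@arg_maxP _ _ _ j xpredT (fun i => d i / w i)) => // i _ imax.
exists (d i / w i), i; split.
- by apply: lt_le_trans (imax j isT); rewrite divr_gt0.
- by rewrite divfK// gt_eqF.
- by move=> k; rewrite -ler_pdivrMr//; apply: imax.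
Qed.

(** Otherwise, at an index where c w touches d from above, d <= A d <= c A w < c w = d. This is the
    uniqueness principle for fixed points. *)
Lemma subinvariant_le0 A w d : nonneg_mx A -> (forall i, 0 < w i) ->
  (forall i, mxact A w i < w i) -> (forall i, d i <= mxact A d i) ->
  forall i, d i <= 0.
Proof.
move=> A0 w0 Aw dA j; rewrite leNgt; apply/negP => dj.
have [c [i [c0 di dk]]] := max_ratio w0 dj.
have := dA i; rewrite leNgt => /negP; apply.
apply: (le_lt_trans (mxact_le A0 dk i)).
by rewrite mxactZ di ltr_pM2l.
Qed.

Lemma entry_bound (x : 'I_m -> R) : exists2 M, 0 < M & forall i, `|x i| <= M.
Proof.
exists (1 + \sum_i `|x i|); first by rewrite ltr_wpDr// sumr_ge0.
move=> i; rewrite (bigD1 i)//= addrCA lerDl addr_ge0// sumr_ge0//.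
Qed.

Lemma mxact_norm_bound A : exists2 M, 0 < M & forall x b, (forall i, `|x i| <= b) ->
  forall i, `|mxact A x i| <= M * b.
Proof.
have [M M0 hM] := entry_bound (fun i => \sum_j `|A i j|).
exists M => // x b xb i.
apply: (le_trans (ler_norm_sum _ _ _)).
apply: (@le_trans _ _ (\sum_j `|A i j| * b)).
  by apply: ler_sum => j _; rewrite normrM ler_wpM2l.
rewrite -mulr_suml ler_wpM2r//; first exact: le_trans (xb i).
by apply: le_trans (hM i); apply: ler_norm.
Qed.

Lemma unitmx_solve A (b : 'I_m -> R) : A \in unitmx ->
  exists x, forall i, mxact A x i = b i.
Proof.
move=> uA; exists (fun i => (invmx A *m (\col_i b i)) i 0) => i.
transitivity ((A *m (invmx A *m (\col_i b i))) i 0); first by rewrite mxE.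
by rewrite mulmxA mulmxV// mul1mx mxE.
Qed.

Lemma mxact_scalar_sub A t x i : mxact (t%:M - A) x i = t * x i - mxact A x i.
Proof.
rewrite /mxact -sumrN.
under eq_bigr => j _ do rewrite !mxE mulrBl.
rewrite sumrB sumrN; congr (_ - _).
rewrite (bigD1 i)//= eqxx mulr1n big1 ?addr0// => j ji.
by rewrite eq_sym (negbTE ji) mulr0n mul0r.
Qed.

(* The infimum s of the t having a positive w with A w < t w is not larger than
   1: otherwise s - A is invertible, and the solution x of (t - A) x = 1 for t
   close to s remains bounded, so it also satisfies A x < (s - e) x. *)
Lemma unit_above1_superinvariant A : nonneg_mx A ->
  (forall t, 1 < t -> t%:M - A \in unitmx) ->
  forall t, 1 < t -> exists2 w, (forall i, 0 < w i) &
    (forall i, mxact A w i < t * w i).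
Proof.
move=> A0 uA t0 t01; apply: contrapT => nt0.
pose T : set R := [set t | exists2 w, (forall i, 0 < w i) &
    (forall i, mxact A w i < t * w i)].
have Tup s t : s <= t -> T s -> T t.
  move=> st [w w0 Aw]; exists w => // i; apply: (lt_le_trans (Aw i)).
  by rewrite ler_pM2r.
have Tlb : lbound T t0.
  by move=> t Tt; rewrite leNgt; apply/negP => /ltW/Tup/(_ Tt).
have T0 : T !=set0.
  have [M M0 hM] := entry_bound (fun i => \sum_j A i j).
  exists (M + 1); exists (fun=> 1) => // i; rewrite mulr1 /mxact.
  under eq_bigr => j _ do rewrite mulr1.
  apply: le_lt_trans (ler_norm _) _; apply: le_lt_trans (hM i) _; lra.
have iT : has_inf T by split => //; exists t0.
pose s := inf T.
have s1 : 1 < s by apply: (lt_le_trans t01); apply: lb_le_inf.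
have [N N0 hN] := mxact_norm_bound (invmx (s%:M - A)).
(* [N] bounds the inverse of s - A in the sup norm. With t - s < e, the largest entry X of x
   satisfies X <= N (1 + e X) = N + X / 4, so X <= 2 N; then (t - s) x <= 1/2 and e x / 4 <= 1/8,
   which leaves (s - e/4) x - A x > 0. *)
pose e := (4%:R * N)^-1.
have e0 : 0 < e by rewrite invr_gt0 mulr_gt0.
have [t Tt ts] := inf_adherent e0 iT; rewrite -/s in ts.
have st : s <= t by apply: inf_lbound => //; case: iT.
have t1 : 1 < t by lra.
have t_gt0 : 0 < t by lra.
have [x xE] := unitmx_solve (fun=> 1) (uA _ t1).
have xt i : t * x i = mxact A x i + 1.
  by have := xE i; rewrite mxact_scalar_sub; lra.
have x_ge0 i : 0 <= x i.
  case: Tt => w w0 Aw.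
  (* Membership of t in [T] gives a positive w that A / t strictly decreases, and t x = A x + 1
     makes -x subinvariant for A / t. *)
  have := @subinvariant_le0 (t^-1 *: A) w (fun i => - x i) _ w0 _ _ i.
  rewrite oppr_le0; apply.
  - by move=> k l; rewrite mxE mulr_ge0// invr_ge0 ltW.
  - move=> k; rewrite (_ : mxact _ _ _ = t^-1 * mxact A w k); last first.
      by rewrite /mxact mulr_sumr; apply: eq_bigr => l _; rewrite mxE mulrA.
    by rewrite mulrC ltr_pdivrMr// mulrC.
  - move=> k; rewrite (_ : mxact _ _ _ = - (t^-1 * mxact A x k)); last first.
      by rewrite /mxact mulr_sumr -sumrN; apply: eq_bigr => l _; rewrite mxE mulrN mulrA.
    rewrite lerN2 mulrC ler_pdivrMr// mulrC xt; lra.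
have x_gt0 i : 0 < x i.
  have := mxact_ge0 A0 x_ge0 i; have := xt i => xi Ax.
  have : 0 < t * x i by lra.
  by rewrite pmulr_rgt0.
have xs i : mxact (s%:M - A) x i = 1 - (t - s) * x i.
  by rewrite mxact_scalar_sub; have := xt i; lra.
have xN i : x i = mxact (invmx (s%:M - A)) (fun i => 1 - (t - s) * x i) i.
  rewrite -(funext xs).
  have us := uA _ s1.
  transitivity ((invmx (s%:M - A) *m ((s%:M - A) *m (\col_i x i))) i 0).
    by rewrite mulmxA mulVmx// mul1mx mxE.
  rewrite mxE /mxact; apply: eq_bigr => j _; congr (_ * _).
  by rewrite mxE; apply: eq_bigr => k _; congr (_ * _); rewrite mxE.
have eN : e * N = 4%:R^-1 by rewrite /e invfM -mulrA mulVf ?mulr1// gt_eqF.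
have xb i : x i <= 2%:R * N.
  pose k := [arg max_(k > i) x k]%O.
  have kmax j : x j <= x k by rewrite /k; case: arg_maxP => // l _ lmax; apply: lmax.
  apply: (le_trans (kmax i)).
  have b1 j : `|1 - (t - s) * x j| <= 1 + e * x k.
    have h1 : 0 <= (t - s) * x j by rewrite mulr_ge0// subr_ge0.
    have h2 : (t - s) * x j <= e * x k by apply: ler_pM => //; rewrite ?subr_ge0//; lra.
    rewrite ler_norml; apply/andP; split; lra.
  have := hN _ _ b1 k; rewrite -xN ger0_norm// mulrDr mulr1 mulrA [N * e]mulrC eN.
  lra.
have sT : T (s - e / 4%:R).
  exists x => // i.
  have h1 := xs i; rewrite mxact_scalar_sub in h1.
  have h2 : (t - s) * x i <= e * (2%:R * N).
    by apply: ler_pM; rewrite ?subr_ge0//; lra.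
  have h3 : e * x i <= e * (2%:R * N) by rewrite ler_pM2l.
  rewrite mulrCA eN in h2 h3.
  have -> : (s - e / 4%:R) * x i = s * x i - (e * x i) / 4%:R by rewrite mulrBl mulrAC.
  lra.
have : s <= s - e / 4%:R by apply: inf_lbound => //; case: iT.
lra.
Qed.

Lemma exprn_lt_above1 k c : 1 < c -> exists2 t, 1 < t & t ^+ k < c.
Proof.
move=> c1; elim: k c c1 => [|k IH] c c1; first by exists 2%:R; rewrite ?expr0//; lra.
have [|t t1 tk] := IH ((1 + c) / 2%:R); first lra.
have g0 : 0 < (1 + c) / 2%:R by lra.
have h : 1 < c / ((1 + c) / 2%:R) by rewrite ltr_pdivlMr//; lra.
exists (Num.min t (c / ((1 + c) / 2%:R))); first by rewrite lt_min t1 h.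
set u := Num.min _ _.
have u1 : 1 < u by rewrite lt_min t1 h.
have u0 : 0 < u by lra.
have ut : u <= t by rewrite ge_min lexx.
have uc : u <= c / ((1 + c) / 2%:R) by rewrite ge_min lexx orbT.
rewrite exprS -(@ltr_pdivlMl _ u)//.
apply: (le_lt_trans (lerXn2r _ _ _ ut)); rewrite ?nnegrE; try lra.
apply: (lt_le_trans tk).
by rewrite ler_pdivlMl// -ler_pdivlMr.
Qed.

(** Choose t > 1 with t^k < c and a positive w with A w < t w. Where b w touches d, c d <= A^k d <=
    t^k b w = t^k d < c d. This is the form in which the hypothesis on the eigenvalues is used. *)
Lemma unit_above1_no_growth A d k c : nonneg_mx A ->
  (forall t, 1 < t -> t%:M - A \in unitmx) -> 1 < c ->
  (forall i, c * d i <= iter k (mxact A) d i) -> forall i, d i <= 0.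
Proof.
move=> A0 uA c1 cd j; rewrite leNgt; apply/negP => dj.
have [t t1 tk] := exprn_lt_above1 k c1.
have [w w0 Aw] := unit_above1_superinvariant A0 uA t1.
have [b [i [b0 di dk]]] := max_ratio w0 dj.
have : iter k (mxact A) d i <= t ^+ k * (b * w i).
  elim: k {c1 cd tk} (i) => [|k IH] l /=; first by rewrite expr0 mul1r.
  apply: (le_trans (mxact_le A0 IH l)).
  have t0 : 0 < t by lra.
  by rewrite !mxactZ exprSr -mulrA ler_pM2l ?exprn_gt0// mulrCA ler_pM2l// ltW.
apply/negP; rewrite -ltNge -di; apply: lt_le_trans (cd i).
by rewrite ltr_pM2r// di mulr_gt0.
Qed.

(** Take w = (1 - 2 A)^-1 1, a finite Neumann series because A is nilpotent; then A w = (w - 1) /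
    2. *)
Lemma nilpotent_contracted A k : nonneg_mx A -> A ^+ k = 0 ->
  exists2 w, (forall i, 0 < w i) & (forall i, mxact A w i <= w i / 2%:R).
Proof.
move=> A0 Ak.
have it0 l i : 0 <= iter l (mxact A) (fun=> 1) i by apply: iter_mxact_ge0.
have itk i : iter k (mxact A) (fun=> 1) i = 0.
  by rewrite iter_mxactE Ak /mxact big1// => j _; rewrite mxE mul0r.
exists (fun i => \sum_(l < k.+1) 2%:R ^+ l * iter l (mxact A) (fun=> 1) i).
  move=> i; rewrite big_ord_recl /= expr0 mul1r ltr_pwDl// sumr_ge0// => l _.
  by apply: mulr_ge0; [exact: exprn_ge0|exact: (it0 l.+1)].
move=> i; rewrite {1}/mxact.
under eq_bigr => j _ do rewrite mulr_sumr.
rewrite exchange_big big_ord_recr /= [X in _ + X]big1 ?addr0; last first.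
  by move=> j _; rewrite itk !mulr0.
rewrite big_ord_recl /= mulrDl -[leLHS]add0r lerD//.
rewrite mulr_suml ler_sum// => l _.
rewrite /bump /= add1n add0n exprS mulrAC [2%:R * _]mulrC mulfK ?pnatr_eq0//.
by rewrite /mxact mulr_sumr ler_sum// => j _; rewrite mulrCA.
Qed.

(** * Matrices that are positive along a strongly connected graph *)

Section irreducible.
Variables (e : rel 'I_m) (A : 'M[R]_m).
Hypotheses (A0 : nonneg_mx A) (Ae : forall i j, e i j -> 0 < A i j).
Hypothesis conn : forall i j, connect e i j.

Lemma irreducible_pos v j : (forall i, 0 <= v i) -> 0 < v j ->
  (forall i, mxact A v i <= v i) -> forall i, 0 < v i.
Proof.
move=> v0 + Av i; have /connectP[p pth ->] := conn i j.
elim: p i pth => //= k p IH i /andP[eik /IH pk] vj.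
apply: lt_le_trans (Av i); apply: lt_le_trans (mxact_ge_term i k A0 v0).
by rewrite mulr_gt0 ?Ae ?pk.
Qed.

(** A sum of powers is taken because the graph may be periodic, and then no single power of [A] need
    make [v] positive. *)
Lemma irreducible_sum_pos v j : (forall i, 0 <= v i) -> 0 < v j ->
  exists k, forall i, 0 < \sum_(l < k) iter l (mxact A) v i.
Proof.
move=> v0 vj.
have it0 l i : 0 <= iter l (mxact A) v i by apply: iter_mxact_ge0.
have ex i : exists k, 0 < iter k (mxact A) v i.
  have /connectP[p pth jE] := conn i j; subst j.
  elim: p i pth vj => [|k p IH] i /=; first by exists 0%N.
  move=> /andP[eik /IH pk] /pk[n hn]; exists n.+1 => /=.
  apply: lt_le_trans (mxact_ge_term i k A0 (it0 n)).
  by rewrite mulr_gt0 ?Ae.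
have [n hn] := fin_all_exists ex.
exists (\max_i n i).+1 => i.
have ni : (n i < (\max_i n i).+1)%N by rewrite ltnS leq_bigmax.
rewrite (bigD1 (Ordinal ni))//= ltr_pwDl// sumr_ge0//.
Qed.

(** A Harnack inequality: the product of the entries of [A] along a path from i to j bounds v i / v
    j from below. The point is that [c] depends on [A] only, not on [v]. *)
Lemma irreducible_ratio : exists2 c, 0 < c & forall v, (forall i, 0 <= v i) ->
  (forall i, mxact A v i <= v i) -> forall i j, c * v j <= v i.
Proof.
have ex (ij : 'I_m * 'I_m) : exists c, 0 < c /\ forall v, (forall i, 0 <= v i) ->
  (forall i, mxact A v i <= v i) -> c * v ij.2 <= v ij.1.
  case: ij => i j /=; have /connectP[p pth ->] := conn i j.
  elim: p i pth => [|k p IH] i /=; first by exists 1; split => // v _ _; rewrite mul1r.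
  move=> /andP[eik /IH[c [c0 hc]]]; exists (A i k * c); split.
    by rewrite mulr_gt0 ?Ae.
  move=> v v0 Av; apply: le_trans (Av i); apply: le_trans (mxact_ge_term i k A0 v0).
  by rewrite -mulrA ler_pM2l ?Ae//; apply: hc.
have [c hc] := fin_all_exists ex.
exists (\big[Num.min/1]_ij c ij).
  by apply: (big_ind (fun x => 0 < x)) => // [x y x0 y0|ij _]; [rewrite lt_min x0|case: (hc ij)].
move=> v v0 Av i j; apply: le_trans ((hc (i, j)).2 v v0 Av).
by rewrite ler_wpM2r// bigmin_le_cond.
Qed.

End irreducible.
End nonneg_matrices.

(** * Polynomials with nonnegative coefficients and monomials *)

Section nonneg_polynomials.
Variable R : realType.
Implicit Types p q : {poly R}.

Definition nonneg_poly p := forall i, 0 <= p`_i.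

Lemma nonneg_polyC c : 0 <= c -> nonneg_poly c%:P.
Proof. by move=> c0 i; rewrite coefC; case: ifP. Qed.

Lemma nonneg_polyX : nonneg_poly 'X.
Proof. by move=> i; rewrite coefX ler0n. Qed.

Lemma nonneg_polyD p q : nonneg_poly p -> nonneg_poly q -> nonneg_poly (p + q).
Proof. by move=> p0 q0 i; rewrite coefD addr_ge0. Qed.

Lemma nonneg_polyM p q : nonneg_poly p -> nonneg_poly q -> nonneg_poly (p * q).
Proof. by move=> p0 q0 i; rewrite coefM sumr_ge0// => j _; rewrite mulr_ge0. Qed.

Lemma nonneg_polyZ c p : 0 <= c -> nonneg_poly p -> nonneg_poly (c *: p).
Proof. by move=> c0 p0 i; rewrite coefZ mulr_ge0. Qed.

Lemma nonneg_polyXn p n : nonneg_poly p -> nonneg_poly (p ^+ n).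
Proof.
move=> p0; elim: n => [|n IH]; first by rewrite expr0; apply: nonneg_polyC.
by rewrite exprS; apply: nonneg_polyM.
Qed.

Lemma nonneg_poly_sum (I : Type) (r : seq I) (F : I -> {poly R}) :
  (forall i, nonneg_poly (F i)) -> nonneg_poly (\sum_(i <- r) F i).
Proof.
move=> F0; apply: (big_ind nonneg_poly) => // [|p q]; first exact: nonneg_polyC.
exact: nonneg_polyD.
Qed.

Lemma nonneg_poly_prod (I : Type) (r : seq I) (F : I -> {poly R}) :
  (forall i, nonneg_poly (F i)) -> nonneg_poly (\prod_(i <- r) F i).
Proof.
move=> F0; apply: (big_ind nonneg_poly) => // [|p q]; first exact: nonneg_polyC.
exact: nonneg_polyM.
Qed.

Lemma nonneg_poly_ge0 p x : nonneg_poly p -> 0 <= x -> 0 <= p.[x].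
Proof.
by move=> p0 x0; rewrite horner_coef sumr_ge0// => i _; rewrite mulr_ge0// exprn_ge0.
Qed.

Lemma nonneg_poly_le p x y : nonneg_poly p -> 0 <= x -> x <= y -> p.[x] <= p.[y].
Proof.
move=> p0 x0 xy; rewrite !horner_coef ler_sum// => i _.
by rewrite ler_wpM2l// lerXn2r ?nnegrE// (le_trans x0).
Qed.

Lemma nonneg_poly_gt0 p : nonneg_poly p -> p != 0 -> 0 < p.[1].
Proof.
move=> p0 pn0; rewrite horner_coef.
have sp : (0 < size p)%N by rewrite size_poly_gt0.
have lp : ((size p).-1 < size p)%N by rewrite prednK.
rewrite (bigD1 (Ordinal lp))//= expr1n mulr1 ltr_pwDl//.
  by rewrite lt_def p0 andbT -/(lead_coef p) lead_coef_eq0.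
by rewrite sumr_ge0// => i _; rewrite expr1n mulr1.
Qed.

Lemma nonneg_poly_deriv p : nonneg_poly p -> nonneg_poly p^`().
Proof. by move=> p0 i; rewrite coef_deriv mulrn_wge0. Qed.

Lemma poly_drop2 p : p = (p`_0)%:P + p`_1 *: 'X + drop_poly 2 p * 'X^2.
Proof.
rewrite -{1}(poly_take_drop 2 p); congr (_ + _); apply/polyP => -[|[|i]].
all: by rewrite coef_take_poly coefD coefC coefZ coefX /= ?mulr0 ?mulr1 ?addr0 ?add0r.
Qed.

Lemma nonneg_poly_drop n p : nonneg_poly p -> nonneg_poly (drop_poly n p).
Proof. by move=> p0 i; rewrite coef_drop_poly. Qed.

(** * Convexity on [0, 1], read off p = p_0 + p_1 X + r X^2 with r nonnegative *)

Section segment.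
Variable p : {poly R}.
Hypothesis p0 : nonneg_poly p.
Let r := drop_poly 2 p.

Let hornerp t : p.[t] = p`_0 + p`_1 * t + r.[t] * t ^+ 2.
Proof. by rewrite {1}[p]poly_drop2 -/r !hornerE. Qed.

Let hornerdp t : p^`().[t] = p`_1 + r^`().[t] * t ^+ 2 + 2%:R * r.[t] * t.
Proof.
rewrite {1}[p]poly_drop2 -/r !derivD derivC derivZ derivX derivM derivXn.
rewrite !(hornerD, hornerM, hornerMn, hornerC, hornerZ, hornerX, hornerXn) /=; ring.
Qed.

Let r_ge0 : nonneg_poly r. Proof. exact: nonneg_poly_drop. Qed.

Lemma nonneg_poly_tangent : p^`().[0] <= p.[1] - p.[0].
Proof.
rewrite hornerdp !hornerp expr0n expr1n /= !mulr0 !mulr1.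
have := nonneg_poly_ge0 r_ge0 (@ler01 R); lra.
Qed.

(** The derivative is convex too, so its integral is at most the trapezoid. This is sharper than the
    bound by the slope at 1, and the case a = 0 depends on it. *)
Lemma nonneg_poly_trapezoid : 2%:R * (p.[1] - p.[0]) <= p^`().[0] + p^`().[1].
Proof.
rewrite !hornerdp !hornerp expr0n expr1n /= !mulr0 !mulr1.
have := nonneg_poly_ge0 (nonneg_poly_deriv r_ge0) (@ler01 R); lra.
Qed.

Lemma nonneg_poly_chord t : 0 <= t -> t <= 1 ->
  p.[t] <= (1 - t) * p.[0] + t * p.[1].
Proof.
move=> t0 t1; rewrite !hornerp expr0n expr1n /= !mulr0 !mulr1.
have h1 := nonneg_poly_le r_ge0 t0 t1.
have h2 := nonneg_poly_ge0 r_ge0 t0.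
have h3 : r.[t] * t ^+ 2 <= r.[1] * t.
  apply: ler_pM => //; first exact: exprn_ge0.
  by rewrite expr2 ler_piMr.
lra.
Qed.

Lemma nonneg_poly_strict : (2 < size p)%N ->
  p^`().[0] < p.[1] - p.[0] /\ p.[1] - p.[0] < p^`().[1].
Proof.
move=> sp; rewrite !hornerdp !hornerp expr0n expr1n /= !mulr0 !mulr1.
have rn0 : r != 0 by rewrite -size_poly_eq0 size_drop_poly subn_eq0 -ltnNge.
have := nonneg_poly_gt0 r_ge0 rn0.
have := nonneg_poly_ge0 (nonneg_poly_deriv r_ge0) (@ler01 R); lra.
Qed.

End segment.
End nonneg_polynomials.

(** [uniq] is required because the filter [j != i] removes every copy of i. *)
Lemma deriv_prod (R : comNzRingType) (I : eqType) (r : seq I) (F : I -> {poly R}) :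
  uniq r -> (\prod_(i <- r) F i)^`() =
    \sum_(i <- r) (F i)^`() * \prod_(j <- r | j != i) F j.
Proof.
elim: r => [|k r IH]; first by rewrite !big_nil derivC.
move=> /= /andP[kr /IH E]; rewrite !big_cons derivM E eqxx /=; congr (_ * _ + _).
  rewrite big_seq [RHS]big_seq_cond; apply: eq_bigl => j.
  by case: (boolP (j \in r)) => // jr; rewrite (memPn kr).
rewrite mulr_sumr [LHS]big_seq [RHS]big_seq; apply: eq_bigr => j jr.
by rewrite big_cons eq_sym (memPn kr)// mulrCA.
Qed.

(** * Monomials and their derivatives along segments of nonnegative points *)

Section monomials.
Variables (R : realType) (m : nat).
Implicit Types (x t : R) (u v B C : 'I_m -> R) (n : mindex m) (j : 'I_m).

Definition rmon x v n : R := x ^+ n.1 * \prod_j v j ^+ n.2 j.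

Definition mpred j n : mindex m := (n.1, [ffun l => (n.2 l - (l == j))%N]).

(* If n.2 j = 0, the truncated subtraction in mpred does no harm, since the
   factor (n.2 j)%:R vanishes. *)
Definition dmon j x v n : R := (n.2 j)%:R * rmon x v (mpred j n).

Lemma rmon_ge0 x v n : 0 <= x -> (forall i, 0 <= v i) -> 0 <= rmon x v n.
Proof.
by move=> x0 v0; rewrite mulr_ge0 ?exprn_ge0// prodr_ge0// => i _; rewrite exprn_ge0.
Qed.

Lemma rmon_gt0 x v n : 0 < x -> (forall i, 0 < v i) -> 0 < rmon x v n.
Proof.
by move=> x0 v0; rewrite mulr_gt0 ?exprn_gt0// prodr_gt0// => i _; rewrite exprn_gt0.
Qed.

Lemma rmon_le x x' v v' n : 0 <= x -> x <= x' -> (forall i, 0 <= v i) ->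
  (forall i, v i <= v' i) -> rmon x v n <= rmon x' v' n.
Proof.
move=> x0 xx v0 vv; apply: ler_pM.
- exact: exprn_ge0.
- by rewrite prodr_ge0// => i _; rewrite exprn_ge0.
- by rewrite lerXn2r ?nnegrE// (le_trans x0).
- apply: ler_prod => i _; rewrite exprn_ge0//= lerXn2r ?nnegrE//.
  exact: le_trans (vv i).
Qed.

Lemma dmon_ge0 j x v n : 0 <= x -> (forall i, 0 <= v i) -> 0 <= dmon j x v n.
Proof. by move=> x0 v0; rewrite mulr_ge0 ?ler0n// rmon_ge0. Qed.

Lemma dmon_gt0 j x v n : 0 < x -> (forall i, 0 < v i) -> (0 < n.2 j)%N ->
  0 < dmon j x v n.
Proof. by move=> x0 v0 nj; apply: mulr_gt0; [rewrite ltr0n|apply: rmon_gt0]. Qed.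

Lemma dmon_le j x x' v v' n : 0 <= x -> x <= x' -> (forall i, 0 <= v i) ->
  (forall i, v i <= v' i) -> dmon j x v n <= dmon j x' v' n.
Proof. by move=> *; rewrite ler_wpM2l ?ler0n// rmon_le. Qed.

Definition segment_poly (C d : 'I_m -> R) (k : {ffun 'I_m -> nat}) : {poly R} :=
  \prod_j ((C j)%:P + d j *: 'X) ^+ k j.

Lemma segment_poly_ge0 C d k : (forall i, 0 <= C i) -> (forall i, 0 <= d i) ->
  nonneg_poly (segment_poly C d k).
Proof.
move=> C0 d0; apply: nonneg_poly_prod => j; apply: nonneg_polyXn.
by apply: nonneg_polyD; [apply: nonneg_polyC|apply: nonneg_polyZ => //; apply: nonneg_polyX].
Qed.

Lemma horner_segment_poly C d k t :
  (segment_poly C d k).[t] = \prod_j (C j + t * d j) ^+ k j.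
Proof.
rewrite horner_prod; apply: eq_bigr => j _.
by rewrite !hornerE [d j * t]mulrC.
Qed.

Lemma deriv_segment_poly C d n :
  (segment_poly C d n.2)^`() =
  \sum_j ((n.2 j)%:R * d j) *: segment_poly C d (mpred j n).2.
Proof.
rewrite deriv_prod ?index_enum_uniq//; apply: eq_bigr => j _.
have dE : ((C j)%:P + d j *: 'X)^`() = (d j)%:P.
  by rewrite derivD derivC derivZ derivX add0r alg_polyC.
rewrite deriv_exp dE /segment_poly [in RHS](bigD1 j)//= ffunE eqxx.
rewrite -scaler_nat mul_polyC scalerA -scalerAl.
rewrite subn1; congr (_ *: (_ * _)).
by apply: eq_bigr => l lj; rewrite ffunE (negbTE lj) subn0.
Qed.

Lemma size_segment_poly C d k : (forall i, 0 < d i) ->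
  size (segment_poly C d k) = (\sum_j k j).+1.
Proof.
move=> d0.
have s2 j : size ((C j)%:P + d j *: 'X) = 2%N.
  rewrite addrC size_polyDl size_scale ?gt_eqF// size_polyX//.
  by rewrite size_polyC; case: (_ != _).
have nz j : (C j)%:P + d j *: 'X != 0 by rewrite -size_poly_gt0 s2.
rewrite size_prod; last by move=> j _; rewrite expf_neq0.
have -> : (\sum_j size (((C j)%:P + d j *: 'X) ^+ k j) = \sum_j k j + m)%N.
  rewrite -[X in (_ + X)%N]card_ord -sum1_card -big_split /=; apply: eq_bigr => j _.
  have := size_exp ((C j)%:P + d j *: 'X) (k j); rewrite s2 mul1n => E.
  by rewrite addn1 -[in RHS]E prednK// size_poly_gt0 expf_neq0.
by rewrite -addSn cardT size_enum_ord addnK.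
Qed.

Section between.
Variables (x : R) (C B : 'I_m -> R).
Hypotheses (x0 : 0 <= x) (C0 : forall i, 0 <= C i) (CB : forall i, C i <= B i).
Let d i := B i - C i.
Let d0 i : 0 <= d i. Proof. by rewrite subr_ge0. Qed.
Let p n := x ^+ n.1 *: segment_poly C d n.2.

Let p_ge0 n : nonneg_poly (p n).
Proof. by apply: nonneg_polyZ; [apply: exprn_ge0|apply: segment_poly_ge0]. Qed.

Let p_at0 n : (p n).[0] = rmon x C n.
Proof.
rewrite /p hornerZ horner_segment_poly; congr (_ * _).
by apply: eq_bigr => j _; rewrite mul0r addr0.
Qed.

Let p_at1 n : (p n).[1] = rmon x B n.
Proof.
rewrite /p hornerZ horner_segment_poly; congr (_ * _).
by apply: eq_bigr => j _; rewrite mul1r subrKC.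
Qed.

Let dp n : (p n)^`() = \sum_j ((n.2 j)%:R * d j) *: p (mpred j n).
Proof.
rewrite /p derivZ deriv_segment_poly scaler_sumr; apply: eq_bigr => j _.
by rewrite !scalerA mulrC.
Qed.

Let dp_at0 n : (p n)^`().[0] = \sum_j d j * dmon j x C n.
Proof.
rewrite dp horner_sum; apply: eq_bigr => j _.
by rewrite hornerZ p_at0 -mulrA mulrCA.
Qed.

Let dp_at1 n : (p n)^`().[1] = \sum_j d j * dmon j x B n.
Proof.
rewrite dp horner_sum; apply: eq_bigr => j _.
by rewrite hornerZ p_at1 -mulrA mulrCA.
Qed.

Lemma rmon_tangent n : rmon x C n + \sum_j (B j - C j) * dmon j x C n <= rmon x B n.
Proof.
have := nonneg_poly_tangent (p_ge0 n).
rewrite dp_at0 p_at0 p_at1 /d; set s := \sum_(_ | _) _; lra.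
Qed.

Lemma rmon_trapezoid n : 2%:R * rmon x B n <=
  2%:R * rmon x C n +
  (\sum_j (B j - C j) * dmon j x C n + \sum_j (B j - C j) * dmon j x B n).
Proof.
have := nonneg_poly_trapezoid (p_ge0 n).
rewrite dp_at0 dp_at1 p_at0 p_at1 /d.
set s := \sum_(_ | _) _; set s' := \sum_(_ | _) _; lra.
Qed.

(** Subtract the lower tangent bound from the trapezoid bound. *)
Lemma rmon_tangent_upper n :
  rmon x B n <= rmon x C n + \sum_j (B j - C j) * dmon j x B n.
Proof.
have := rmon_trapezoid n; have := rmon_tangent n.
set s := \sum_(_ | _) _; set s' := \sum_(_ | _) _; lra.
Qed.

Lemma rmon_strict n : 0 < x -> (forall i, C i < B i) -> (1 < \sum_j n.2 j)%N ->
  rmon x C n + \sum_j (B j - C j) * dmon j x C n < rmon x B n /\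
  rmon x B n < rmon x C n + \sum_j (B j - C j) * dmon j x B n.
Proof.
move=> x_gt0 CltB n2.
have [] := nonneg_poly_strict (p_ge0 n).
  rewrite /p size_scale ?expf_neq0 ?gt_eqF// size_segment_poly ?ltnS// => i.
  by rewrite subr_gt0.
rewrite dp_at0 dp_at1 p_at0 p_at1 /d.
set s := \sum_(_ | _) _; set s' := \sum_(_ | _) _; lra.
Qed.

End between.

(** Either Y_j is absent and the factor [n.2 j] vanishes, or it is the only Y-factor and
    differentiation leaves a monomial free of Y. *)
Lemma dmon_lin j x u v n : (\sum_l n.2 l <= 1)%N -> dmon j x u n = dmon j x v n.
Proof.
move=> n1; rewrite /dmon; case: (posnP (n.2 j)) => [->|nj]; first by rewrite !mul0r.
congr (_ * (_ * _)); apply: eq_bigr => l _; rewrite ffunE.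
suff -> : (n.2 l - (l == j) = 0)%N by rewrite !expr0.
move: n1; rewrite (bigD1 j)//=; have [->|lj] := eqVneq l j.
  by move=> h; apply/eqP; rewrite subn_eq0; apply: leq_trans h; apply: leq_addr.
rewrite (bigD1 l)//= => h; rewrite subn0; apply/eqP; rewrite -leqn0.
rewrite -(leq_add2l 1); apply: leq_trans h; apply: leq_add => //.
exact: leq_addr.
Qed.

Lemma rmon_lin x C B n : 0 <= x -> (forall i, 0 <= C i) -> (forall i, C i <= B i) ->
  (\sum_l n.2 l <= 1)%N ->
  rmon x B n = rmon x C n + \sum_j (B j - C j) * dmon j x B n.
Proof.
move=> x0 C0 CB n1; apply/eqP; rewrite eq_le rmon_tangent_upper//=.
have := rmon_tangent x0 C0 CB n.
suff -> : \sum_j (B j - C j) * dmon j x C n = \sum_j (B j - C j) * dmon j x B n by [].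
by apply: eq_bigr => j _; rewrite (@dmon_lin j x C B n n1).
Qed.

(** Here z moves together with Y, from (0, U) to (x, U + D): this links the nilpotent point at z = 0
    with points at small z > 0. *)
Lemma rmon_chord x U D t n : 0 <= x -> (forall i, 0 <= U i) -> (forall i, 0 <= D i) ->
  0 <= t -> t <= 1 ->
  rmon (t * x) (fun i => U i + t * D i) n <=
  (1 - t) * rmon 0 U n + t * rmon x (fun i => U i + D i) n.
Proof.
move=> x0 U0 D0 t0 t1.
pose p := (x *: 'X) ^+ n.1 * segment_poly U D n.2.
have p0 : nonneg_poly p.
  apply: nonneg_polyM (segment_poly_ge0 _ _ _) => //; apply: nonneg_polyXn.
  by apply: nonneg_polyZ => //; apply: nonneg_polyX.
have pE s : p.[s] = rmon (s * x) (fun i => U i + s * D i) n.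
  by rewrite /p !hornerE horner_segment_poly [x * s]mulrC.
have := nonneg_poly_chord p0 t0 t1; rewrite !pE mul0r mul1r.
by under [fun i => U i + 0 * _]eq_fun => i do rewrite mul0r addr0;
   under [fun i => U i + 1 * _]eq_fun => i do rewrite mul1r.
Qed.

Lemma dmon_chord j x U D t n : 0 <= x -> (forall i, 0 <= U i) ->
  (forall i, 0 <= D i) -> 0 <= t -> t <= 1 ->
  dmon j (t * x) (fun i => U i + t * D i) n <=
  (1 - t) * dmon j 0 U n + t * dmon j x (fun i => U i + D i) n.
Proof.
move=> x0 U0 D0 t0 t1; rewrite /dmon.
rewrite [(1 - t) * _]mulrCA [t * (_ * _)]mulrCA -mulrDr ler_wpM2l ?ler0n//.
exact: rmon_chord.
Qed.

Lemma cvg_rmon (T : Type) (F : set_system T) (FF : Filter F) (a : T -> R) x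
    (w : T -> 'I_m -> R) v n :
  a s @[s --> F] --> x -> (forall j, w s j @[s --> F] --> v j) ->
  rmon (a s) (w s) n @[s --> F] --> rmon x v n.
Proof.
have cX (b : T -> R) (y : R) (k : nat) : b s @[s --> F] --> y -> b s ^+ k @[s --> F] --> y ^+ k.
  move=> by_; elim: k => [|k IH]; first by under eq_fun do rewrite expr0; apply: cvg_cst.
  by under eq_fun do rewrite exprS; rewrite exprS; apply: cvgM.
move=> ax wv; apply: cvgM; first exact: cX.
elim: (index_enum _) => [|j r IH].
  by under eq_fun do rewrite big_nil; rewrite big_nil; apply: cvg_cst.
under eq_fun do rewrite big_cons; rewrite big_cons.
by apply: cvgM => //; apply: cX.
Qed.

Lemma cvg_dmon (T : Type) (F : set_system T) (FF : Filter F) (a : T -> R) x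
    (w : T -> 'I_m -> R) v j n :
  a s @[s --> F] --> x -> (forall j, w s j @[s --> F] --> v j) ->
  dmon j (a s) (w s) n @[s --> F] --> dmon j x v n.
Proof. by move=> ax wv; apply: cvgM; [apply: cvg_cst|apply: cvg_rmon]. Qed.

End monomials.

Lemma cvg_psum (R : realType) (I : choiceType) (T : Type) (F : set_system T)
    (FF : Filter F) (f : T -> I -> R) (g : I -> R) (G : {fset I}) :
  (forall n, f s n @[s --> F] --> g n) ->
  psum (f s) G @[s --> F] --> psum g G.
Proof.
move=> fg; rewrite /psum; elim: (enum_fset G) => [|n r IH].
  by under eq_fun do rewrite big_nil; rewrite big_nil; apply: cvg_cst.
by under eq_fun do rewrite big_cons; rewrite big_cons; apply: cvgD.
Qed.

(** * Power series with nonnegative coefficients *)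

Section univariate.
Variable R : realType.
Implicit Types f g : nat -> R.

Lemma psum_ord f N : psum f [fset k in iota 0 N]%fset = \sum_(k < N) f k.
Proof.
rewrite /psum -(big_mkord xpredT) /index_iota subn0.
apply: perm_big; apply: uniq_perm; rewrite ?fset_uniq ?iota_uniq// => k.
by rewrite !inE.
Qed.

Lemma psum_truncate f G N : (forall k, 0 <= f k) ->
  psum (fun k => if (k < N)%N then f k else 0) G <= \sum_(k < N) f k.
Proof.
move=> f0; rewrite -psum_ord /psum.
rewrite (big_fsetID _ (fun k => k < N)%N G) /= [X in _ + X]big1_seq ?addr0; last first.
  by move=> k /andP[_]; rewrite !inE /= => /andP[_ /negbTE ->].
apply: (@le_trans _ _ (psum f [fset k | k in G & (k < N)%N]%fset)).
  by apply: psum_le => k; case: ifP.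
apply: psum_sub => //; apply/fsubsetP => k; rewrite !inE /= mem_iota add0n.
by case/andP.
Qed.

Lemma has_nsum_head (c : R) : 0 <= c -> has_nsum (fun k => if k == 0%N then c else 0) c.
Proof.
move=> c0; split=> [G|M /(_ [fset 0%N]%fset)]; last by rewrite psum1.
have := @psum_truncate (fun=> c) G 1 (fun=> c0); rewrite big_ord1.
apply: le_trans; apply: psum_le => -[|k] //.
Qed.

(** Cancel the common terms below [N]. The terms of [f] beyond [N] are at most (x / x1)^(N+1) times
    the sum at [x1], so dividing by x^N gives g_N - f_N = O(x), and x tends to 0. *)
Lemma power_sum_coef_le f g x1 (s : R -> R) N : 0 < x1 ->
  (forall k, 0 <= f k) -> (forall k, 0 <= g k) ->
  (forall x, 0 < x -> x <= x1 -> has_nsum (fun k => f k * x ^+ k) (s x) /\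
     has_nsum (fun k => g k * x ^+ k) (s x)) ->
  (forall k, (k < N)%N -> f k = g k) -> g N <= f N.
Proof.
move=> x10 f0 g0 fg eqN; rewrite leNgt; apply/negP => lt.
have [fx1 _] := fg _ x10 (lexx _).
have s1 := has_nsum_ge0 fx1.
have key x : 0 < x -> x <= x1 -> g N - f N <= x * (s x1 / x1 ^+ N.+1).
  move=> x0 xx1; have [hf hg] := fg _ x0 xx1.
  pose c := (x / x1) ^+ N.+1.
  have c0 : 0 <= c by rewrite exprn_ge0// divr_ge0// ltW.
  have up : s x <= \sum_(k < N.+1) f k * x ^+ k + c * s x1.
    apply: hf.2 => G.
    apply: (@le_trans _ _ (psum (fun k => (if (k < N.+1)%N then f k * x ^+ k else 0)
       + c * (f k * x1 ^+ k)) G)).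
      apply: psum_le => k; case: ltnP => kN.
        by rewrite lerDl !mulr_ge0// exprn_ge0// ltW.
      rewrite add0r mulrCA ler_wpM2l//.
      have -> : x ^+ k = (x / x1) ^+ k * x1 ^+ k by rewrite -exprMn divfK// gt_eqF.
      rewrite ler_wpM2r ?exprn_ge0 ?(ltW x10)//.
      have q0 : 0 <= x / x1 by rewrite divr_ge0// ltW.
      have q1 : x / x1 <= 1 by rewrite ler_pdivrMr// mul1r.
      by rewrite /c ler_wiXn2l.
    rewrite psumD psumZ lerD ?ler_wpM2l ?(fx1.1)//.
    by apply: psum_truncate => k; rewrite mulr_ge0// exprn_ge0// ltW.
  have low : \sum_(k < N.+1) g k * x ^+ k <= s x.
    by rewrite -(psum_ord (fun k => g k * x ^+ k)); apply: hg.1.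
  have := le_trans low up; rewrite !big_ord_recr /=.
  have -> : \sum_(k < N) g k * x ^+ k = \sum_(k < N) f k * x ^+ k.
    by apply: eq_bigr => k _; rewrite eqN.
  rewrite -addrA lerD2l -lerBlDl -mulrBl.
  have -> : c * s x1 = (x * (s x1 / x1 ^+ N.+1)) * x ^+ N.
    by rewrite /c expr_div_n [x ^+ N.+1]exprS; set z := (_ ^+ N.+1)^-1; ring.
  by rewrite ler_pM2r// exprn_gt0.
pose S := s x1 / x1 ^+ N.+1.
have S0 : 0 <= S by rewrite divr_ge0// exprn_ge0// ltW.
pose e := g N - f N; have e0 : 0 < e by rewrite subr_gt0.
(* Makes x S < e; the 1 keeps the denominator positive when S = 0. *)
pose x := Num.min x1 (e / (2%:R * (S + 1))).
have x0 : 0 < x by rewrite lt_min x10 divr_gt0// mulr_gt0//; lra.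
have xx1 : x <= x1 by rewrite ge_min lexx.
have := key x x0 xx1; rewrite -/S -/e.
apply/negP; rewrite -ltNge.
have xe : x <= e / (2%:R * (S + 1)) by rewrite ge_min lexx orbT.
apply: (@le_lt_trans _ _ (e / (2%:R * (S + 1)) * S)); first by rewrite ler_wpM2r.
rewrite mulrAC ltr_pdivrMr; last by rewrite mulr_gt0//; lra.
rewrite ltr_pM2l//; lra.
Qed.

Lemma power_sum_inj f g x1 (s : R -> R) : 0 < x1 ->
  (forall k, 0 <= f k) -> (forall k, 0 <= g k) ->
  (forall x, 0 < x -> x <= x1 -> has_nsum (fun k => f k * x ^+ k) (s x) /\
     has_nsum (fun k => g k * x ^+ k) (s x)) -> f =1 g.
Proof.
move=> x10 f0 g0 fg n; elim/ltn_ind: n => n IH.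
apply/eqP; rewrite eq_le.
have := @power_sum_coef_le f g x1 s n x10 f0 g0 fg IH => ->; rewrite andbT.
apply: (@power_sum_coef_le g f x1 s n) => // [x x0 xx1|k /IH//].
by have [] := fg x x0 xx1.
Qed.

End univariate.

Section exhaustion.
Variable T : countType.

Definition exhaust (k : nat) : {fset T} := [fset n in pmap choice.unpickle (iota 0 k)]%fset.

Lemma exhaust_sub k l : (k <= l)%N -> (exhaust k `<=` exhaust l)%fset.
Proof.
move=> kl; apply/fsubsetP => n; rewrite !inE !mem_pmap => /mapP[p].
rewrite mem_iota add0n => pk E; apply/mapP; exists p => //.
by rewrite mem_iota add0n (leq_trans _ kl).
Qed.

Lemma exhaust_ex (G : {fset T}) : exists k, (G `<=` exhaust k)%fset.
Proof.
exists (\max_(n <- enum_fset G) choice.pickle n).+1; apply/fsubsetP => n nG.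
rewrite !inE mem_pmap; apply/mapP; exists (choice.pickle n); last by rewrite choice.pickleK.
by rewrite mem_iota add0n ltnS /=; apply: leq_bigmax_seq.
Qed.

End exhaustion.

(** * Fixed points of systems with nonnegative coefficients *)

Section real_system.
Variables (R : realType) (m : nat) (h : 'I_m -> mindex m -> R).
Hypothesis h0 : forall i n, 0 <= h i n.
Implicit Types (x a t : R) (u v w B C V : 'I_m -> R) (J : 'M[R]_m).

Definition rterm i x v n := h i n * rmon x v n.
Definition rdterm i j x v n := h i n * dmon j x v n.
(** Convergence is part of the relation, so boundary points of the domain need no separate
    treatment. At such a point [rjac] may hold for no matrix. *)
Definition rfix x B := forall i, has_nsum (rterm i x B) (B i).
Definition rjac x B J := forall i j, has_nsum (rdterm i j x B) (J i j).

Lemma rterm_ge0 i x v n : 0 <= x -> (forall i, 0 <= v i) -> 0 <= rterm i x v n.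
Proof. by move=> *; rewrite mulr_ge0// rmon_ge0. Qed.

Lemma rdterm_ge0 i j x v n : 0 <= x -> (forall i, 0 <= v i) -> 0 <= rdterm i j x v n.
Proof. by move=> *; rewrite mulr_ge0// dmon_ge0. Qed.

Lemma rterm_le i x x' v v' n : 0 <= x -> x <= x' -> (forall i, 0 <= v i) ->
  (forall i, v i <= v' i) -> rterm i x v n <= rterm i x' v' n.
Proof. by move=> *; rewrite ler_wpM2l// rmon_le. Qed.

Lemma rdterm_le i j x x' v v' n : 0 <= x -> x <= x' -> (forall i, 0 <= v i) ->
  (forall i, v i <= v' i) -> rdterm i j x v n <= rdterm i j x' v' n.
Proof. by move=> *; rewrite ler_wpM2l// dmon_le. Qed.

Lemma rfix_ge0 x B : rfix x B -> forall i, 0 <= B i.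
Proof. by move=> fB i; apply: has_nsum_ge0 (fB i). Qed.

Lemma rjac_ge0 x B J : rjac x B J -> nonneg_mx J.
Proof. by move=> jJ i j; apply: has_nsum_ge0 (jJ i j). Qed.

Lemma rjac_uniq x B J J' : rjac x B J -> rjac x B J' -> J = J'.
Proof. by move=> jJ jJ'; apply/matrixP => i j; apply: has_nsum_uniq (jJ i j) (jJ' i j). Qed.

Lemma rjac_of_bound x B (M : 'I_m -> 'I_m -> R) :
  (forall i j G, psum (rdterm i j x B) G <= M i j) -> exists J, rjac x B J.
Proof.
move=> hM.
have /choice[f hf] (ij : 'I_m * 'I_m) : exists s, has_nsum (rdterm ij.1 ij.2 x B) s.
  exact: has_nsum_ex (hM ij.1 ij.2).
by exists (\matrix_(i, j) f (i, j)) => i j; rewrite mxE; exact: (hf (i, j)).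
Qed.

Lemma rjac_dom x x' B B' J' : 0 <= x -> x <= x' -> (forall i, 0 <= B i) ->
  (forall i, B i <= B' i) -> rjac x' B' J' -> exists J, rjac x B J.
Proof.
move=> x0 xx B0 BB jJ'; apply: (@rjac_of_bound _ _ (fun i j => J' i j)) => i j G.
by apply: le_trans ((jJ' i j).1 G); apply: psum_le => n; apply: rdterm_le.
Qed.

Lemma rjac_le x x' B B' J J' : 0 <= x -> x <= x' -> (forall i, 0 <= B i) ->
  (forall i, B i <= B' i) -> rjac x B J -> rjac x' B' J' -> forall i j, J i j <= J' i j.
Proof.
move=> x0 xx B0 BB jJ jJ' i j.
by apply: has_nsum_le (jJ i j) (jJ' i j) => n; apply: rdterm_le.
Qed.

(** [C'] is the end of the segment where the derivatives are taken: [C] for lower bounds, [B] for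
    upper bounds. *)
Lemma has_nsum_taylor i x B C s J : 0 <= x -> (forall i, 0 <= C i) ->
  (forall i, C i <= B i) -> (forall i, 0 <= B i) -> forall C',
  (forall i, 0 <= C' i) ->
  has_nsum (rterm i x C) s -> rjac x C' J ->
  has_nsum (fun n => rterm i x C n + h i n * \sum_j (B j - C j) * dmon j x C' n)
    (s + mxact J (fun j => B j - C j) i).
Proof.
move=> x0 C0 CB B0 C' C'0 hs jJ.
have d0 j : 0 <= B j - C j by rewrite subr_ge0.
have := @has_nsum_lincomb R _ _ (fun j => B j - C j) (fun j => rdterm i j x C') (J i) d0.
move=> /(_ (fun j n => rdterm_ge0 i j n x0 C'0) (jJ i)) hl.
have eM : \sum_j (B j - C j) * J i j = mxact J (fun j => B j - C j) i.
  by apply: eq_bigr => j _; rewrite mulrC.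
rewrite eM in hl.
have eT n : \sum_j (B j - C j) * rdterm i j x C' n =
    h i n * \sum_j (B j - C j) * dmon j x C' n.
  by rewrite mulr_sumr; apply: eq_bigr => j _; rewrite mulrCA.
apply: has_nsum_ext (has_nsumD _ _ hs hl) => n; first by rewrite eT.
- exact: rterm_ge0.
- by rewrite sumr_ge0// => j _; rewrite mulr_ge0// rdterm_ge0.
Qed.

Lemma rterm_tangent i x a C B n : 0 <= x -> x <= a -> (forall i, 0 <= C i) ->
  (forall i, C i <= B i) ->
  rterm i x C n + h i n * \sum_j (B j - C j) * dmon j x C n <= rterm i a B n.
Proof.
move=> x0 xa C0 CB.
rewrite /rterm -mulrDr ler_wpM2l//; apply: (le_trans (rmon_tangent x0 C0 CB n)).
by apply: rmon_le => // k; apply: le_trans (CB k).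
Qed.

(** By convexity each partial derivative at [C] is at most a difference quotient towards [B], which
    is finite as all coordinates of [B] are strictly larger. *)
Lemma rjac_below x a C B s : 0 <= x -> x <= a -> (forall i, 0 <= C i) ->
  (forall i, C i < B i) -> (forall i, has_nsum (rterm i a B) (s i)) ->
  exists J, rjac x C J.
Proof.
move=> x0 xa C0 CltB fB.
have CB k : C k <= B k by apply: ltW.
apply: (@rjac_of_bound _ _ (fun i j => (B j - C j)^-1 * s i)) => i j G.
have dj : 0 < B j - C j by rewrite subr_gt0.
rewrite mulrC ler_pdivlMr// mulrC -psumZ.
apply: le_trans ((fB i).1 G); apply: psum_le => n.
apply: le_trans (rterm_tangent i n x0 xa C0 CB); rewrite ler_wpDl ?rterm_ge0//.
rewrite mulrCA ler_wpM2l// (bigD1 j)//= lerDl sumr_ge0// => l _.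
by rewrite mulr_ge0 ?subr_ge0// dmon_ge0.
Qed.

Section two_points.
Variables (x a : R) (C B : 'I_m -> R).
Hypotheses (x0 : 0 <= x) (xa : x <= a) (CB : forall i, C i <= B i).
Hypotheses (fC : rfix x C) (fB : rfix a B).
Let C0 := rfix_ge0 fC.
Let B0 := rfix_ge0 fB.

Let tangent_term i n :
  rterm i x C n + h i n * \sum_j (B j - C j) * dmon j x C n <= rterm i a B n.
Proof. exact: rterm_tangent. Qed.

Lemma rfix_tangent J : rjac x C J ->
  forall i, mxact J (fun j => B j - C j) i <= B i - C i.
Proof.
move=> jJ i; have := has_nsum_taylor x0 C0 CB B0 C0 (fC i) jJ.
by move=> /(has_nsum_le (tangent_term i))/(_ (fB i)); lra.
Qed.

Lemma rfix_tangent_lt J i n : rjac x C J -> h i n != 0 ->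
  rmon x C n + \sum_j (B j - C j) * dmon j x C n < rmon a B n ->
  mxact J (fun j => B j - C j) i < B i - C i.
Proof.
move=> jJ hn lt; have hs := has_nsum_taylor x0 C0 CB B0 C0 (fC i) jJ.
suff : C i + mxact J (fun j => B j - C j) i < B i by lra.
apply: (@has_nsum_lt _ _ _ _ _ _ n _ (tangent_term i) _ hs (fB i)); last first.
  by rewrite /rterm -mulrDr ltr_pM2l// lt_def hn /=.
move=> k; rewrite /rterm -mulrDr mulr_ge0// addr_ge0 ?rmon_ge0// sumr_ge0// => j _.
by rewrite mulr_ge0 ?subr_ge0// dmon_ge0.
Qed.

End two_points.

Section same_argument.
Variables (x : R) (C B : 'I_m -> R).
Hypotheses (x0 : 0 <= x) (CB : forall i, C i <= B i) (fC : rfix x C) (fB : rfix x B).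
Let C0 := rfix_ge0 fC.
Let B0 := rfix_ge0 fB.

Let upper_term i n :
  rterm i x B n <= rterm i x C n + h i n * \sum_j (B j - C j) * dmon j x B n.
Proof. by rewrite /rterm -mulrDr ler_wpM2l// rmon_tangent_upper. Qed.

(** The argument z is the same at both points: an increase of z alone would enlarge B - C without
    being seen by the derivatives in Y. *)
Lemma rfix_upper J : rjac x B J ->
  forall i, B i - C i <= mxact J (fun j => B j - C j) i.
Proof.
move=> jJ i; have := has_nsum_taylor x0 C0 CB B0 B0 (fC i) jJ.
by move=> /(has_nsum_le (upper_term i) (fB i)); lra.
Qed.

Lemma rfix_upper_lt J i n : rjac x B J -> h i n != 0 ->
  rmon x B n < rmon x C n + \sum_j (B j - C j) * dmon j x B n ->
  B i - C i < mxact J (fun j => B j - C j) i.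
Proof.
move=> jJ hn lt; have hs := has_nsum_taylor x0 C0 CB B0 B0 (fC i) jJ.
suff : B i < C i + mxact J (fun j => B j - C j) i by lra.
apply: (@has_nsum_lt _ _ _ _ _ _ n _ (upper_term i) _ (fB i) hs); last first.
  by rewrite /rterm -mulrDr ltr_pM2l// lt_def hn /=.
by move=> k; apply: rterm_ge0.
Qed.

Lemma rfix_trapezoid JC JB : rjac x C JC -> rjac x B JB ->
  forall i, 2%:R * (B i - C i) <=
    mxact JC (fun j => B j - C j) i + mxact JB (fun j => B j - C j) i.
Proof.
move=> jC jB i.
have hC := has_nsum_taylor x0 C0 CB B0 C0 (fC i) jC.
have hB := has_nsum_taylor x0 C0 CB B0 B0 (fC i) jB.
have d0 j : 0 <= B j - C j by rewrite subr_ge0.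
have g0 v : (forall i, 0 <= v i) ->
  forall n, 0 <= rterm i x C n + h i n * \sum_j (B j - C j) * dmon j x v n.
  move=> v0 n; rewrite addr_ge0 ?rterm_ge0// mulr_ge0// sumr_ge0// => j _.
  by rewrite mulr_ge0// dmon_ge0.
have := has_nsumD (g0 _ C0) (g0 _ B0) hC hB.
have h2 := @has_nsumZ R _ 2%:R _ _ (ler0n _ _) (fB i).
move=> /(has_nsum_le _ h2) H.
suff : 2%:R * B i <= C i + mxact JC (fun j => B j - C j) i +
   (C i + mxact JB (fun j => B j - C j) i) by lra.
apply: H => n; rewrite /rterm -!mulrDr mulrCA ler_wpM2l//.
have := rmon_trapezoid x0 C0 CB n.
set s := \sum_(_ | _) _; set s' := \sum_(_ | _) _; lra.
Qed.

End same_argument.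

(** * Polynomial iterates and their limits *)

Section iterates.

Definition pmon (v : 'I_m -> {poly R}) (n : mindex m) : {poly R} :=
  'X ^+ n.1 * \prod_j v j ^+ n.2 j.

Fixpoint approx (k : nat) : 'I_m -> {poly R} :=
  if k is k'.+1 then
    fun i => \sum_(n <- exhaust (mindex m) k') h i n *: pmon (approx k') n
  else fun=> 0.

Lemma horner_approxS k i x : (approx k.+1 i).[x] =
  psum (rterm i x (fun j => (approx k j).[x])) (exhaust (mindex m) k).
Proof.
rewrite /= horner_sum; apply: eq_bigr => n _; rewrite hornerZ; congr (_ * _).
rewrite hornerM hornerXn horner_prod; congr (_ * _).
by apply: eq_bigr => j _; rewrite horner_exp.
Qed.

Lemma approx_nonneg k i : nonneg_poly (approx k i).
Proof.
elim: k i => [|k IH] i /=; first exact: nonneg_polyC.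
apply: nonneg_poly_sum => n; apply: nonneg_polyZ => //; apply: nonneg_polyM.
  by apply: nonneg_polyXn; apply: nonneg_polyX.
by apply: nonneg_poly_prod => j; apply: nonneg_polyXn.
Qed.

(** The coefficientwise order; nonnegativity of the smaller side is included to make it compatible
    with products. *)
Let lep (p q : {poly R}) := nonneg_poly p /\ nonneg_poly (q - p).

Let lepM p q p' q' : lep p q -> lep p' q' -> lep (p * p') (q * q').
Proof.
move=> [p0 pq] [p'0 p'q']; split; first exact: nonneg_polyM.
have -> : q * q' - p * p' = (q - p) * (q' - p') + (q - p) * p' + p * (q' - p') by ring.
by apply: nonneg_polyD; first apply: nonneg_polyD; apply: nonneg_polyM.
Qed.

Lemma approx_coef_le k i l : (approx k i)`_l <= (approx k.+1 i)`_l.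
Proof.
suff [_ /(_ l)] : lep (approx k i) (approx k.+1 i) by rewrite coefB subr_ge0.
elim: k i {l} => [|k IH] i.
  split; first exact: nonneg_polyC.
  by rewrite [approx 0 i]/= subr0; apply: approx_nonneg.
split; first exact: approx_nonneg.
have lepX p q n : lep p q -> lep (p ^+ n) (q ^+ n).
  move=> pq; elim: n => [|n IHn]; last by rewrite !exprS; apply: lepM.
  by rewrite !expr0; split; rewrite ?subrr; apply: nonneg_polyC.
have step n : nonneg_poly (h i n *: pmon (approx k.+1) n - h i n *: pmon (approx k) n).
  rewrite -scalerBr; apply: nonneg_polyZ => //.
  suff [] : lep (pmon (approx k) n) (pmon (approx k.+1) n) by [].
  apply: lepM.
    split; last by rewrite subrr; apply: nonneg_polyC.
    by apply: nonneg_polyXn; apply: nonneg_polyX.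
  apply: (big_ind2 lep) => // [|j _]; last exact: lepX.
  by split; rewrite ?subrr; apply: nonneg_polyC.
move=> l; rewrite coefB subr_ge0 /= !coef_sum.
(* First the inner iterate grows over a fixed set of exponents, then the set grows. *)
apply: (@le_trans _ _ (psum (fun n => (h i n *: pmon (approx k.+1) n)`_l)
   (exhaust (mindex m) k))).
  by apply: ler_sum => n _; rewrite -subr_ge0 -coefB; apply: step.
apply: psum_sub (exhaust_sub _ (leqnSn k)) => n.
rewrite coefZ mulr_ge0//; apply: nonneg_polyM.
  by apply: nonneg_polyXn; apply: nonneg_polyX.
by apply: nonneg_poly_prod => j; apply: nonneg_polyXn; apply: approx_nonneg.
Qed.

Lemma nonneg_poly_coef_le (p q : {poly R}) x : nonneg_poly q -> 0 <= x ->
  (forall l, p`_l <= q`_l) -> p.[x] <= q.[x].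
Proof.
move=> q0 x0 pq.
rewrite (@horner_coef_wide _ (maxn (size p) (size q)) p) ?leq_maxl//.
rewrite (@horner_coef_wide _ (maxn (size p) (size q)) q) ?leq_maxr//.
by apply: ler_sum => l _; rewrite ler_wpM2r// exprn_ge0.
Qed.

Lemma approx_le_fix x B k i : 0 <= x -> rfix x B -> (approx k i).[x] <= B i.
Proof.
move=> x0 fB; elim: k i => [|k IH] i.
  by rewrite /= horner0; apply: rfix_ge0 fB i.
rewrite horner_approxS; apply: le_trans ((fB i).1 (exhaust (mindex m) k)).
by apply: psum_le => n; apply: rterm_le => // j; apply: nonneg_poly_ge0 => //; apply: approx_nonneg.
Qed.

Lemma nondecreasing_bounded_cvg (f : nat -> R) M : (forall k, f k <= f k.+1) ->
  (forall k, f k <= M) ->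
  exists l, f k @[k --> \oo] --> l /\ (forall k, f k <= l).
Proof.
move=> fS fM; have nd : nondecreasing_seq f by apply/nondecreasing_seqP.
have ub : has_ubound (range f) by exists M => _ [k _ <-].
exists (sup (range f)); split; first exact: nondecreasing_cvgn.
by move=> k; apply: ub_le_sup => //; exists k.
Qed.

(** Monotone convergence. A finite sum of H at the limit is a limit of finite sums at the iterates,
    each below the next iterate once [exhaust] contains its exponents; conversely each iterate is a
    finite sum at a smaller point. *)
Lemma approx_limit x (M : 'I_m -> R) : 0 <= x ->
  (forall k i, (approx k i).[x] <= M i) ->
  exists V, [/\ forall i, (approx k i).[x] @[k --> \oo] --> V i,
    forall k i, (approx k i).[x] <= V i & rfix x V].
Proof.
move=> x0 hM.
have aS i k : (approx k i).[x] <= (approx k.+1 i).[x].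
  by apply: nonneg_poly_coef_le => //; [apply: approx_nonneg|apply: approx_coef_le].
have /choice[V hV] i := nondecreasing_bounded_cvg (aS i) (hM^~ i).
have cV i : (approx k i).[x] @[k --> \oo] --> V i by case: (hV i).
have leV k i : (approx k i).[x] <= V i by case: (hV i).
have a0 k i : 0 <= (approx k i).[x] by apply: nonneg_poly_ge0 => //; apply: approx_nonneg.
exists V; split => // i; split=> [G|M' hM'].
  have [k0 Gk0] := exhaust_ex G.
  have cG : psum (rterm i x (fun j => (approx k j).[x])) G @[k --> \oo] -->
      psum (rterm i x V) G.
    apply: cvg_psum => n; apply: cvgM; first exact: cvg_cst.
    by apply: cvg_rmon => //; apply: cvg_cst.
  apply: (cvgr_to_le cG); near=> k.
  apply: le_trans (leV k.+1 i); rewrite horner_approxS.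
  apply: psum_sub; first by move=> n; apply: rterm_ge0.
  apply: fsubset_trans Gk0 (exhaust_sub _ _).
  by near: k; apply: nbhs_infty_ge.
apply: (cvgr_to_le (cV i)); near=> k.
have := aS i k; rewrite horner_approxS => /le_trans; apply.
apply: le_trans (hM' (exhaust (mindex m) k)).
by apply: psum_le => n; apply: rterm_le.
Unshelve. all: by end_near.
Qed.

End iterates.

(** * The iterates converge coefficientwise to the given solution *)

Section solution.
Variable y : 'I_m -> nat -> R.
Hypothesis y0 : forall i k, 0 <= y i k.

Definition gsum x V := forall i, has_nsum (fun k => y i k * x ^+ k) (V i).

Definition approx_coefs_cvg :=
  forall i l, (approx k i)`_l @[k --> \oo] --> y i l.

(** The limit over k and the sum over l are both suprema, hence commute. *)
Lemma approx_coefs_gsum (z : 'I_m -> nat -> R) x i s : 0 <= x ->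
  (forall l, (approx k i)`_l @[k --> \oo] --> z i l) ->
  (forall k l, (approx k i)`_l <= z i l) ->
  (approx k i).[x] @[k --> \oo] --> s -> (forall k, (approx k i).[x] <= s) ->
  has_nsum (fun l => z i l * x ^+ l) s.
Proof.
move=> x0 cz lez cs les.
have hE k : (approx k i).[x] =
    psum (fun l => (approx k i)`_l * x ^+ l) [fset l in iota 0 (size (approx k i))]%fset.
  by rewrite psum_ord horner_coef.
have t0 k l : 0 <= (approx k i)`_l * x ^+ l.
  by rewrite mulr_ge0 ?exprn_ge0//; apply: approx_nonneg.
split=> [G|M hM].
  have cG : psum (fun l => (approx k i)`_l * x ^+ l) G @[k --> \oo] -->
      psum (fun l => z i l * x ^+ l) G.
    by apply: cvg_psum => l; apply: cvgM => //; apply: cvg_cst.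
  apply: (cvgr_to_le cG); near=> k; apply: le_trans (les k).
  rewrite horner_coef.
  apply: le_trans (psum_truncate G _ (t0 k)); apply: psum_le => l.
  by case: ltnP => // sl; rewrite nth_default// mul0r.
apply: (cvgr_to_le cs); near=> k; rewrite hE.
apply: le_trans (hM [fset l in iota 0 (size (approx k i))]%fset).
by apply: psum_le => l; rewrite ler_wpM2r// exprn_ge0.
Unshelve. all: by end_near.
Qed.

Lemma gsum_uniq x V V' : gsum x V -> gsum x V' -> V = V'.
Proof. by move=> g g'; apply/funext => i; apply: has_nsum_uniq (g i) (g' i). Qed.

(** On [0, x1] the limit V' of the iterates is a fixed point below V, and V - V' <= J (V - V') with
    J contracting w forces V' = V. So the series of limit coefficients and [y] have equal sums on
    (0, x1], hence equal coefficients. *)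
Lemma approx_coefs_cvg_of_small x1 w : 0 < x1 -> (forall i, 0 < w i) ->
  (forall x, 0 <= x -> x <= x1 -> exists V J, [/\ gsum x V, rfix x V, rjac x V J &
     forall i, mxact J w i < w i]) -> approx_coefs_cvg.
Proof.
move=> x10 w0 small i.
have lim x : 0 <= x -> x <= x1 -> exists V, [/\ gsum x V,
    forall i, (approx k i).[x] @[k --> \oo] --> V i
    & forall k i, (approx k i).[x] <= V i].
  move=> xge0 xx1; have [V [J [gV fV jJ Jw]]] := small x xge0 xx1.
  have [V' [cV' leV' fV']] := approx_limit xge0 (fun k i => approx_le_fix k i xge0 fV).
  have V'V i' : V' i' <= V i'.
    by apply: (cvgr_to_le (cV' i')); near=> k; apply: approx_le_fix.
  suff VV' : V = V' by exists V; rewrite {2 3}VV'.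
  apply/funext => i'; apply/eqP; rewrite eq_le V'V andbT -subr_le0.
  apply: (@subinvariant_le0 R m J w (fun j => V j - V' j)) => //.
    exact: rjac_ge0 jJ.
  exact: (rfix_upper xge0 V'V fV' fV jJ).
have [V1 [g1 c1 le1]] := lim x1 (ltW x10) (lexx _).
have b1 l k : (approx k i)`_l <= V1 i / x1 ^+ l.
  rewrite ler_pdivlMr ?exprn_gt0//; apply: le_trans (le1 k i).
  have t0 n : 0 <= (approx k i)`_n * x1 ^+ n.
    by rewrite mulr_ge0 ?exprn_ge0 ?(ltW x10)//; apply: approx_nonneg.
  rewrite horner_coef; case: (ltnP l (size (approx k i))) => sl.
    by rewrite (bigD1 (Ordinal sl))//= lerDl sumr_ge0.
  by rewrite nth_default// mul0r sumr_ge0.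
have /choice[z hz] l := nondecreasing_bounded_cvg (fun k => approx_coef_le k i l) (b1 l).
have cz l : (approx k i)`_l @[k --> \oo] --> z l by case: (hz l).
have lez k l : (approx k i)`_l <= z l by case: (hz l).
have /choice[s hs] x : exists s, 0 <= x -> x <= x1 ->
    has_nsum (fun k => z k * x ^+ k) s /\ has_nsum (fun k => y i k * x ^+ k) s.
  case: (leP 0 x) => xge0; last by exists 0 => ? ?; exfalso; lra.
  case: (leP x x1) => xx1; last by exists 0 => ? ?; exfalso; lra.
  have [V [gV cV leV]] := lim x xge0 xx1.
  exists (V i) => _ _; split; last exact: gV.
  exact: (@approx_coefs_gsum (fun=> z)).
suff zy : z =1 y i by move=> l; rewrite -zy.
apply: (@power_sum_inj R z (y i) x1 s) => // [l|x xgt0 xx1].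
  by apply: le_trans (lez 0%N l); rewrite /= coef0.
by apply: hs => //; apply: ltW.
Unshelve. all: by end_near.
Qed.

Lemma gsum_dom x x' V : 0 <= x -> x <= x' -> gsum x' V ->
  exists V', gsum x V'.
Proof.
move=> x0 xx g; have /choice[V' hV'] i : exists s, has_nsum (fun k => y i k * x ^+ k) s.
  apply: (has_nsum_dom _ (g i)) => k.
  by rewrite ler_wpM2l// lerXn2r ?nnegrE// (le_trans x0).
by exists V'.
Qed.

Lemma gsum_le x x' V V' : 0 <= x -> x <= x' -> gsum x V -> gsum x' V' ->
  forall i, V i <= V' i.
Proof.
move=> x0 xx g g' i; apply: has_nsum_le (g i) (g' i) => k.
by rewrite ler_wpM2l// lerXn2r ?nnegrE// (le_trans x0).
Qed.

Lemma gsum0 : gsum 0 (fun i => y i 0%N).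
Proof.
move=> i; apply: has_nsum_ext (has_nsum_head (y0 i 0)) => -[|k].
  by rewrite expr0 mulr1.
by rewrite expr0n mulr0.
Qed.

(** Convexity of Y: (t x)^k <= t x^k for every k >= 1. *)
Lemma gsum_chord x t V V' : 0 <= x -> 0 <= t -> t <= 1 -> gsum x V ->
  gsum (t * x) V' -> forall i, V' i <= y i 0%N + t * (V i - y i 0%N).
Proof.
move=> x0 t0 t1 g g' i.
have t1' : 0 <= 1 - t by rewrite subr_ge0.
have hh := has_nsumZ t1' (has_nsum_head (y0 i 0)).
have ht := has_nsumZ t0 (g i).
have h1 (k : nat) : 0 <= (1 - t) * (if k == 0%N then y i 0%N else 0).
  by rewrite mulr_ge0//; case: ifP.
have h2 k : 0 <= t * (y i k * x ^+ k) by rewrite !mulr_ge0// exprn_ge0.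
have : V' i <= (1 - t) * y i 0%N + t * V i; last lra.
apply: has_nsum_le (g' i) (has_nsumD h1 h2 hh ht) => -[|k] /=; first by rewrite !expr0; lra.
rewrite mulr0 add0r exprMn [t * (y _ _ * _)]mulrCA ler_wpM2l//.
rewrite ler_wpM2r// ?exprn_ge0//.
by rewrite exprS ler_piMr// exprn_ile1.
Qed.

Lemma approx_coefs_cvg_of_nilpotent x0 V0 J0 N k : 0 < x0 ->
  (forall x V, 0 <= x -> x <= x0 -> gsum x V -> rfix x V) ->
  gsum x0 V0 -> rjac x0 V0 J0 ->
  rjac 0 (fun i => y i 0%N) N -> N ^+ k = 0 -> approx_coefs_cvg.
Proof.
move=> x00 fx g0 j0 jN Nk.
have [w w0 Nw] := nilpotent_contracted (rjac_ge0 jN) Nk.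
have [M M0 hM] := entry_bound (fun i => mxact J0 w i / w i).
(* By convexity J(x, Y(x)) <= (1 - t) N + t J0 with t = x / x0. As N w <= w / 2 and J0 w <= M w, t M
   <= 1/4 gives J w <= (1/2 + 1/4) w < w. *)
pose t1 := Num.min 1 ((4%:R * M)^-1).
have t10 : 0 < t1 by rewrite lt_min ltr01 invr_gt0 mulr_gt0.
have t11 : t1 <= 1 by rewrite ge_min lexx.
have t1M : t1 * M <= 4%:R^-1.
  have : t1 <= (4%:R * M)^-1 by rewrite ge_min lexx orbT.
  by move=> /(ler_wpM2r (ltW M0)); rewrite invfM -mulrA mulVf ?mulr1// gt_eqF.
have U0 i : 0 <= y i 0%N by [].
have yV0 i : y i 0%N <= V0 i by apply: (gsum_le _ _ gsum0 g0) => //; apply: ltW.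
apply: (@approx_coefs_cvg_of_small (t1 * x0) w) => //; first by rewrite mulr_gt0.
move=> x xge0 xx1.
pose t := x / x0.
have tE : t * x0 = x by rewrite /t divfK// gt_eqF.
have t0 : 0 <= t by rewrite divr_ge0// ltW.
have tt1 : t <= t1 by rewrite ler_pdivrMr.
have t1' : t <= 1 by lra.
have xx0 : x <= x0 by rewrite -tE ler_piMl// ltW.
have [V gV] := gsum_dom xge0 xx0 g0.
have fV := fx _ _ xge0 xx0 gV; have V_ge0 := rfix_ge0 fV.
have [J jJ] := rjac_dom xge0 xx0 V_ge0 (gsum_le xge0 xx0 gV g0) j0.
exists V, J; split => // i.
have JE k' l : J k' l <= (1 - t) * N k' l + t * J0 k' l.
  have h1 := has_nsumZ (_ : 0 <= 1 - t) (jN k' l); rewrite subr_ge0 in h1.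
  have h2 := has_nsumZ t0 (j0 k' l).
  have h3 n : 0 <= (1 - t) * rdterm k' l 0 (fun i => y i 0%N) n.
    by rewrite mulr_ge0 ?subr_ge0// rdterm_ge0.
  have h4 n : 0 <= t * rdterm k' l x0 V0 n.
    by rewrite mulr_ge0// rdterm_ge0// ?ltW// => i'; apply: le_trans (yV0 i').
  apply: has_nsum_le (jJ k' l) (has_nsumD h3 h4 (h1 t1') h2) => n.
  rewrite /rdterm [(1 - t) * _]mulrCA [t * (h _ _ * _)]mulrCA -mulrDr ler_wpM2l//.
  have := @dmon_chord R m l x0 (fun i => y i 0%N) (fun i => V0 i - y i 0%N) t n
    (ltW x00) U0 (fun i => _) t0 t1'.
  have -> : (fun i0 => y i0 0%N + (V0 i0 - y i0 0%N)) = V0.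
    by apply/funext => i'; rewrite subrKC.
  rewrite tE => H; apply: le_trans (H _); last by move=> i'; rewrite subr_ge0.
  apply: dmon_le => // i'; apply: (@gsum_chord x0) => //; first exact: ltW.
  by rewrite tE.
have w_ge0 j : 0 <= w j by apply: ltW.
apply: (@le_lt_trans _ _ ((1 - t) * mxact N w i + t * mxact J0 w i)).
  rewrite /mxact !mulr_sumr -big_split; apply: ler_sum => j _ /=.
  by rewrite !mulrA -mulrDl ler_wpM2r.
have h1 : (1 - t) * mxact N w i <= w i / 2%:R.
  apply: le_trans (Nw i); rewrite ler_piMl ?mxact_ge0//; last by lra.
  exact: rjac_ge0 jN.
have h2 : t * mxact J0 w i <= w i / 4%:R.
  have h3 : mxact J0 w i <= M * w i.
    by rewrite -ler_pdivrMr//; apply: le_trans (hM i); apply: ler_norm.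
  apply: (@le_trans _ _ (t1 * (M * w i))).
    by apply: ler_pM => //; apply: mxact_ge0 => //; apply: rjac_ge0 j0.
  by rewrite mulrA mulrC ler_wpM2l.
have := w0 i; lra.
Qed.

Section cvg.
Hypothesis cy : approx_coefs_cvg.

Let le_y k i l : (approx k i)`_l <= y i l.
Proof.
have nd : nondecreasing_seq (fun k => (approx k i)`_l).
  by apply/nondecreasing_seqP => k'; apply: approx_coef_le.
apply: (cvgr_to_ge (cy (i:=i) (l:=l))); near=> k'.
by apply: nd; near: k'; apply: nbhs_infty_ge.
Unshelve. all: by end_near.
Qed.

(** Extends the equation Y = H(z, Y), known only near 0, to every x >= 0 where the series of Y
    converge. *)
Lemma gsum_rfix x V : 0 <= x -> gsum x V -> rfix x V.
Proof.
move=> x0 gV.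
have leV k i : (approx k i).[x] <= V i.
  rewrite horner_coef -(psum_ord (fun l => (approx k i)`_l * x ^+ l)).
  apply: le_trans ((gV i).1 _).
  by apply: psum_le => l; rewrite ler_wpM2r// exprn_ge0.
have [V' [cV' leV' fV']] := approx_limit x0 leV.
suff -> : V = V' by [].
apply: gsum_uniq gV _ => i; apply: approx_coefs_gsum => // l; exact: cy.
Qed.

Lemma rfix_gsum x B : 0 <= x -> rfix x B ->
  exists V, gsum x V /\ (forall i, V i <= B i).
Proof.
move=> x0 fB.
have [V [cV leV fV]] := approx_limit x0 (fun k i => approx_le_fix k i x0 fB).
exists V; split=> i.
  by apply: approx_coefs_gsum => // l; exact: cy.
by apply: (cvgr_to_le (cV i)); near=> k; apply: approx_le_fix.
Unshelve. all: by end_near.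
Qed.

End cvg.
End solution.
End real_system.

(** * Irreducible systems *)

Lemma strict_ratio (R : realType) m (u w : 'I_m -> R) : (forall i, 0 < w i) ->
  (forall i, u i < w i) -> exists2 q, q < 1 & forall i, u i <= q * w i.
Proof.
move=> w0 uw; exists (\big[Num.max/0]_i (u i / w i)).
  by apply: (big_ind (fun x => x < 1)) => // [x z x1 z1|i _]; rewrite ?gt_max ?x1// ltr_pdivrMr// mul1r.
by move=> i; rewrite -ler_pdivrMr//; apply: le_bigmax_cond.
Qed.

Section irreducible_real_system.
Variables (R : realType) (m : nat) (h : 'I_m -> mindex m -> R).
Hypothesis h0 : forall i n, 0 <= h i n.
Variable y : 'I_m -> nat -> R.
Hypotheses (y0 : forall i k, 0 <= y i k) (y_neq0 : forall i, exists k, y i k != 0).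
Hypothesis cy : approx_coefs_cvg h y.
Let U i := y i 0%N.
Variables (N : 'M[R]_m) (K : nat).
Hypotheses (jN : rjac h 0 U N) (NK : N ^+ K = 0).
Variable e : rel 'I_m.
Hypotheses (eP : forall i j, e i j -> exists n : mindex m, (0 < n.2 j)%N /\ h i n != 0)
  (conn : forall i j, connect e i j).
Implicit Types (x a b t : R) (B C V : 'I_m -> R) (J : 'M[R]_m).

Let gsum := gsum y.
Let rfix := rfix h.
Let rjac := rjac h.

Let gfix x V : 0 <= x -> gsum x V -> rfix x V.
Proof. by move=> x0; apply: gsum_rfix. Qed.

Lemma gsum_at0 V : gsum 0 V -> V = U.
Proof. by move=> gV; apply: gsum_uniq gV _; apply: gsum0. Qed.

Lemma gsum_gt0 x V : 0 < x -> gsum x V -> forall i, 0 < V i.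
Proof.
move=> x0 gV i; have [k yk] := y_neq0 i.
apply: lt_le_trans (has_nsum_term k (gV i)).
by rewrite mulr_gt0 ?exprn_gt0// lt_def yk y0.
Qed.

Lemma rjac_edge_gt0 x B J : 0 < x -> (forall i, 0 < B i) -> rjac x B J ->
  forall i j, e i j -> 0 < J i j.
Proof.
move=> x0 B0 jJ i j /eP[n [nj hn]].
apply: lt_le_trans (has_nsum_term n (jJ i j)).
have hp : 0 < h i n by rewrite lt_def hn h0.
by apply: mulr_gt0 => //; apply: dmon_gt0.
Qed.

Lemma rfix_edge_lt x a C B i j : 0 < x -> x <= a -> (forall i, 0 < C i) ->
  (forall i, C i <= B i) -> rfix x C -> rfix a B -> e i j -> C j < B j -> C i < B i.
Proof.
move=> x0 xa C0 CB fC fB /eP[n [nj hn]] ltj.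
have x_ge0 := ltW x0; have C_ge0 k : 0 <= C k by apply: ltW.
apply: (@has_nsum_lt _ _ _ _ _ _ n _ _ _ (fC i) (fB i)).
- by move=> k; apply: rterm_ge0.
- by move=> k; apply: rterm_le.
rewrite /rterm ltr_pM2l; last by rewrite lt_def hn h0.
have : rmon x B n <= rmon a B n.
  by apply: rmon_le => // k; apply: le_trans (CB k).
apply: lt_le_trans; apply: lt_le_trans (rmon_tangent x_ge0 C_ge0 CB n).
rewrite ltrDl (bigD1 j)//= ltr_pwDl//.
  by rewrite mulr_gt0 ?subr_gt0// dmon_gt0.
by rewrite sumr_ge0// => k _; rewrite mulr_ge0 ?subr_ge0// dmon_ge0.
Qed.

Lemma rfix_all_lt x a C B j : 0 < x -> x <= a -> (forall i, 0 < C i) ->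
  (forall i, C i <= B i) -> rfix x C -> rfix a B -> C j < B j -> forall i, C i < B i.
Proof.
move=> x0 xa C0 CB fC fB + i; have /connectP[p pth ->] := conn i j.
elim: p i pth => //= k p IH i /andP[eik /IH pk] vj.
by apply: (rfix_edge_lt x0 xa C0 CB fC fB eik); apply: pk.
Qed.

Lemma rjac_free a V : (forall i n, h i n != 0 -> n.1 = 0%N) -> rjac 0 V N -> rjac a V N.
Proof.
move=> zf jV i j; apply: has_nsum_ext (jV i j) => n; rewrite /rdterm.
have [->|/zf n1] := eqVneq (h i n) 0; first by rewrite !mul0r.
by rewrite /dmon /rmon /= n1.
Qed.

(** Equal values at two positive arguments leave no term of positive degree in Y, and then none
    involving z in H, so the Jacobian is that at 0. This settles the case in which differences of
    values of Y vanish. *)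
Lemma gsum_constant x a V : 0 < x -> x < a -> gsum x V -> gsum a V ->
  rjac x V N /\ rjac a V N.
Proof.
move=> x0 xa gx ga.
have x_ge0 := ltW x0; have a0 := lt_trans x0 xa; have a_ge0 := ltW a0.
have V0 := gsum_gt0 x0 gx.
have fx := gfix x_ge0 gx; have fa := gfix a_ge0 ga.
have lt1 k : (0 < k)%N -> x ^+ k < a ^+ k.
  by move=> k0; rewrite ltrXn2r// -lt0n.
have VU : V = U.
  apply: (gsum_uniq ga) => i; apply: has_nsum_ext (gsum0 y0 i) => -[|k].
    by rewrite !expr0.
  have [->|yk] := eqVneq (y i k.+1) 0; first by rewrite !mul0r.
  suff : V i < V i by rewrite ltxx.
  apply: (@has_nsum_lt _ _ _ _ _ _ k.+1 _ _ _ (gx i) (ga i)).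
  - by move=> l; rewrite mulr_ge0// exprn_ge0.
  - by move=> l; rewrite ler_wpM2l// lerXn2r// ?nnegrE// ltW.
  by rewrite ltr_pM2l ?lt1// lt_def yk y0.
have zf i n : h i n != 0 -> n.1 = 0%N.
  move=> hn; apply/eqP; rewrite -leqn0 leqNgt; apply/negP => n1.
  suff : V i < V i by rewrite ltxx.
  have V_ge0 k : 0 <= V k by apply: ltW.
  apply: (@has_nsum_lt _ _ _ _ _ _ n _ _ _ (fx i) (fa i)).
  - by move=> l; apply: rterm_ge0.
  - by move=> l; apply: rterm_le => //; apply: ltW.
  rewrite /rterm ltr_pM2l; last by rewrite lt_def hn h0.
  rewrite ltr_pM2r ?lt1//; apply: prodr_gt0 => j _; exact: exprn_gt0.
by rewrite VU; split; apply: rjac_free.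
Qed.

Let nilpotent_w : exists2 w, (forall i, 0 < w i) & (forall i, mxact N w i <= w i / 2%:R).
Proof. exact: nilpotent_contracted (rjac_ge0 jN) NK. Qed.

(** Abel's theorem for nonnegative terms: a finite sum close to B is continuous in x and stays below
    Y(x) <= B. *)
Lemma gsum_left a B (V : R -> 'I_m -> R) : 0 < a -> gsum a B ->
  (forall x, 0 <= x -> x <= a -> gsum x (V x)) ->
  forall i, V x i @[x --> a^'-] --> B i.
Proof.
move=> a0 gB gV i; apply/cvgrPdist_le => d d0.
have [G hG] := has_nsum_approx (gB i) d0.
have cG : psum (fun k => y i k * x ^+ k) G @[x --> a^'-] -->
    psum (fun k => y i k * a ^+ k) G.
  apply: cvg_psum => k; apply: cvgM; first exact: cvg_cst.
  have : x @[x --> a^'-] --> a by apply: cvg_at_left_filter; apply: cvg_id.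
  elim: k => [|k IH] ca; first by under eq_fun do rewrite expr0; apply: cvg_cst.
  by under eq_fun do rewrite exprS; rewrite exprS; apply: cvgM => //; apply: IH.
near=> x.
have xa : x < a by near: x; apply: nbhs_left_lt.
have x0 : 0 < x by near: x; apply: nbhs_left_gt.
have gx := gV x (ltW x0) (ltW xa).
have h1 : V x i <= B i by apply: (gsum_le y0 _ _ gx gB); apply: ltW.
have h2 : B i - d < psum (fun k => y i k * x ^+ k) G.
  by near: x; apply: (cvgr_gt _ cG).
have h3 := (gx i).1 G.
by rewrite ler_distlC; apply/andP; split; lra.
Unshelve. all: by end_near.
Qed.

Lemma gsum_family a B : 0 <= a -> gsum a B ->
  exists V : R -> 'I_m -> R, forall x, 0 <= x -> x <= a -> gsum x (V x).
Proof.
move=> a0 gB.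
have /choice[V hV] x : exists V, 0 <= x -> x <= a -> gsum x V.
  have [x0|x0] := leP 0 x; last by exists B => ? ?; exfalso; lra.
  have [xa|xa] := leP x a; last by exists B => ? ?; exfalso; lra.
  by have [V gV] := gsum_dom y0 x0 xa gB; exists V.
by exists V.
Qed.

(* For x < a, the vector v = Y(a) - Y(x) satisfies J(x, Y(x)) v <= v; by
   irreducibility the ratios of its entries are bounded uniformly in x, which
   bounds the entries of J(a, Y(a)) and lets x tend to a. *)
Lemma gsum_superinvariant a B : 0 <= a -> gsum a B ->
  exists2 J, rjac a B J & forall t, 1 < t -> exists2 w, (forall i, 0 < w i) &
    (forall i, mxact J w i <= t * w i).
Proof.
rewrite le_eqVlt => /predU1P[<- /gsum_at0 ->|a0 gB].
  exists N => // t t1; have [w w0 Nw] := nilpotent_w; exists w => // i.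
  apply: le_trans (Nw i) _; have := w0 i => wi.
  have : 1 * w i <= t * w i by rewrite ler_pM2r// ltW.
  lra.
have [[x [x0 xa gx]]|ncst] := pselect (exists x, [/\ 0 < x, x < a & gsum x B]).
  have [_ jB] := gsum_constant x0 xa gx gB.
  exists N => // t t1; have [w w0 Nw] := nilpotent_w; exists w => // i.
  apply: le_trans (Nw i) _; have := w0 i => wi.
  have : 1 * w i <= t * w i by rewrite ler_pM2r// ltW.
  lra.
have a_ge0 := ltW a0; have fB := gfix a_ge0 gB.
have [V gV] := gsum_family a_ge0 gB.
have VB x : 0 < x -> x < a -> forall i, V x i <= B i.
  by move=> x0 xa; apply: (gsum_le y0 _ _ (gV x _ _) gB); apply: ltW.
have V0 x : 0 < x -> x < a -> forall i, 0 < V x i.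
  by move=> x0 xa; apply: gsum_gt0 (gV x _ _) => //; apply: ltW.
have fV x : 0 < x -> x < a -> rfix x (V x).
  by move=> x0 xa; apply: gfix (ltW x0) (gV x (ltW x0) (ltW xa)).
have ltVB x : 0 < x -> x < a -> forall i, V x i < B i.
  move=> x0 xa.
  have [[j jlt]|nlt] := pselect (exists j, V x j < B j).
    exact: (rfix_all_lt x0 (ltW xa) (V0 x x0 xa) (VB x x0 xa) (fV x x0 xa) fB jlt).
  exfalso; apply: ncst; exists x; split => //.
  suff <- : V x = B by apply: gV; apply: ltW.
  apply/funext => j; apply/eqP; rewrite eq_le VB//= leNgt; apply/negP => lt.
  by apply: nlt; exists j.
have /choice[Jx hJ] x : exists J, 0 < x -> x < a -> rjac x (V x) J.
  have [x0|x0] := ltP 0 x; last by exists N => ? ?; exfalso; lra.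
  have [xa|xa] := ltP x a; last by exists N => ? ?; exfalso; lra.
  have [J jJ] := rjac_below h0 (ltW x0) (ltW xa) (rfix_ge0 (fV x x0 xa)) (ltVB x x0 xa) fB.
  by exists J.
(* A fixed reference point: J(x, Y(x)) increases with x, so the ratio constant of J(x0, Y(x0))
   serves for all x in [x0, a). *)
pose x0 := a / 2%:R.
have x00 : 0 < x0 by rewrite /x0; lra.
have x0a : x0 < a by rewrite /x0; lra.
have [c c0 hc] := irreducible_ratio (rjac_ge0 (hJ x0 x00 x0a))
  (rjac_edge_gt0 x00 (V0 x0 x00 x0a) (hJ x0 x00 x0a)) conn.
pose v x i := B i - V x i.
have v0 x : 0 < x -> x < a -> forall i, 0 < v x i.
  by move=> xx xa i; rewrite subr_gt0 ltVB.
have Jv x : 0 < x -> x < a -> forall i, mxact (Jx x) (v x) i <= v x i.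
  move=> xx xa; apply: (rfix_tangent h0 (ltW xx) (ltW xa) (VB x xx xa) (fV x xx xa) fB).
  exact: hJ.
have cv x : x0 <= x -> x < a -> forall i j, c * v x j <= v x i.
  move=> xx xa; have xp : 0 < x by lra.
  apply: hc => [i|i]; first by apply: ltW; apply: v0.
  apply: le_trans (Jv x xp xa i).
  apply: mxact_leM => [j|k l]; first by apply: ltW; apply: v0.
  apply: (rjac_le h0 (ltW x00) xx _ _ (hJ x0 x00 x0a) (hJ x xp xa)) => j.
    by apply: ltW; apply: V0.
  exact: (gsum_le y0 (ltW x00) xx (gV x0 (ltW x00) (ltW x0a)) (gV x (ltW xp) (ltW xa))).
have Jc x : x0 <= x -> x < a -> forall i j, Jx x i j <= c^-1.
  move=> xx xa i j; have xp : 0 < x by lra.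
  have v_ge0 l : 0 <= v x l by apply: ltW; apply: v0.
  have := le_trans (mxact_ge_term i j (rjac_ge0 (hJ x xp xa)) v_ge0) (Jv x xp xa i).
  have := cv x xx xa j i; rewrite -ler_pdivlMl// => h1 h2.
  by have := le_trans h2 h1; rewrite ler_pM2r ?v0.
have cG i j G : psum (rdterm h i j x (V x)) G @[x --> a^'-] --> psum (rdterm h i j a B) G.
  apply: cvg_psum => n; apply: cvgM; first exact: cvg_cst.
  apply: cvg_dmon; first by apply: cvg_at_left_filter; apply: cvg_id.
  by move=> k; apply: gsum_left.
have [J jJ] : exists J, rjac a B J.
  apply: (@rjac_of_bound _ _ _ _ _ (fun _ _ => c^-1)) => i j G.
  apply: (cvgr_to_le (cG i j G)); near=> x.
  have xa : x < a by near: x; apply: nbhs_left_lt.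
  have xx : x0 <= x by near: x; apply: nbhs_left_ge.
  apply: le_trans (Jc x xx xa i j); apply: ((hJ x _ xa) i j).1; lra.
exists J => // t t1.
(* [v x] tends to 0 as x tends to a, so no limit vector is available; x is fixed near a instead.
   Replacing [Jx x] by J costs at most d times the sum of the entries of v, which is at most (t - 1)
   v i because c v j <= v i. *)
pose d := (t - 1) * c / (m%:R + 1).
have d0 : 0 < d by rewrite /d !mulr_gt0// ?invr_gt0 ?subr_gt0// ltr_wpDl.
have /choice[G hG] (ij : 'I_m * 'I_m) := has_nsum_approx (jJ ij.1 ij.2) d0.
have [x [xx xa xG]] : exists x, [/\ x0 <= x, x < a & forall ij : 'I_m * 'I_m,
    J ij.1 ij.2 - d < psum (rdterm h ij.1 ij.2 x (V x)) (G ij)].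
  apply: (@filter_ex _ (a^'-)); near=> x; split.
  - by near: x; apply: nbhs_left_ge.
  - by near: x; apply: nbhs_left_lt.
  near: x; apply: filter_forall => ij; apply: (cvgr_gt _ (cG _ _ (G ij))); exact: hG.
have xp : 0 < x by lra.
exists (v x) => [i|i]; first exact: v0.
have v_ge0 l : 0 <= v x l by apply: ltW; apply: v0.
have h1 : mxact J (v x) i <= mxact (Jx x) (v x) i + d * \sum_j v x j.
  rewrite /mxact mulr_sumr -big_split; apply: ler_sum => j _ /=.
  rewrite -mulrDl ler_wpM2r//.
  have := xG (i, j) => /=; have := (hJ x xp xa i j).1 (G (i, j)); lra.
have h2 : d * \sum_j v x j <= (t - 1) * v x i.
  have : c * \sum_j v x j <= (m%:R + 1) * v x i.
    rewrite mulr_sumr; apply: (@le_trans _ _ (\sum_(j < m) v x i)).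
      by apply: ler_sum => j _; apply: cv.
    by rewrite sumr_const card_ord -[leLHS]mulr_natl ler_wpM2r// lerDl.
  have m1 : 0 < m%:R + 1 :> R by rewrite ltr_wpDl.
  have -> : d * \sum_j v x j = (t - 1) * ((m%:R + 1)^-1 * (c * \sum_j v x j)).
    by rewrite /d; set S := \sum_j _; set q := _^-1; ring.
  by rewrite ler_pM2l ?subr_gt0// ler_pdivrMl.
have := Jv x xp xa i; lra.
Unshelve. all: by end_near.
Qed.

Lemma iter_mxactB J (v w : 'I_m -> R) k i :
  iter k (mxact J) (fun j => v j - w j) i = iter k (mxact J) v i - iter k (mxact J) w i.
Proof.
elim: k i => //= k IH i; rewrite -mxactB; apply: eq_bigr => j _; congr (_ * _).
exact: IH.
Qed.

Lemma iter_telescope J (v : 'I_m -> R) k i :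
  \sum_(l < k) iter l (mxact J) (fun j => v j - mxact J v j) i =
  v i - iter k (mxact J) v i.
Proof.
elim: k => [|k IH]; first by rewrite big_ord0 subrr.
rewrite big_ord_recr /= IH iter_mxactB -iterSr /=; lra.
Qed.

(** With v = Y(b) - Y(a), J v <= v. Equality in every coordinate happens only for the nilpotent
    matrix [N]; otherwise irreducibility spreads the strict inequality to all coordinates. *)
Lemma gsum_interior_contracted a b B B' J : 0 <= a -> a < b ->
  gsum a B -> gsum b B' -> rjac a B J ->
  exists q w, [/\ q < 1, forall i, 0 < w i & forall i, mxact J w i <= q * w i].
Proof.
move=> a_ge0 ab gB gB' jJ.
have half : J = N -> exists q w, [/\ q < 1, forall i, 0 < w i
    & forall i, mxact J w i <= q * w i].
  move=> ->; have [w w0 Nw] := nilpotent_w.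
  by exists (2%:R^-1), w; split=> // [|i]; [lra|rewrite mulrC].
move: a_ge0; rewrite le_eqVlt => /predU1P[a0|a0].
  move: gB jJ; rewrite -a0 => /gsum_at0 -> jJ; apply: half.
  exact: rjac_uniq jJ jN.
have a_ge0 := ltW a0; have b_ge0 := ltW (lt_trans a0 ab).
have BB' := gsum_le y0 a_ge0 (ltW ab) gB gB'.
have [[j jlt]|nlt] := pselect (exists j, B j < B' j); last first.
  have E : B' = B.
    apply/funext => j; apply/eqP; rewrite eq_le BB' andbT leNgt; apply/negP => lt.
    by apply: nlt; exists j.
  rewrite E in gB'; have [jB _] := gsum_constant a0 ab gB gB'.
  by apply: half; apply: rjac_uniq jJ jB.
have fB := gfix a_ge0 gB; have fB' := gfix b_ge0 gB'.
have B0 := gsum_gt0 a0 gB; have B'0 := gsum_gt0 (lt_trans a0 ab) gB'.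
have ltB := rfix_all_lt a0 (ltW ab) B0 BB' fB fB' jlt.
pose v i := B' i - B i.
have v0 i : 0 < v i by rewrite subr_gt0.
have v_ge0 i : 0 <= v i by apply: ltW.
have J0 := rjac_ge0 jJ.
have Jv := rfix_tangent h0 a_ge0 (ltW ab) BB' fB fB' jJ.
have [[i ilt]|neq] := pselect (exists i, mxact J v i < v i); last first.
  (* Equality forces every monomial of H to be free of z and of degree at most 1 in Y, so J is
     constant and equals [N]. *)
  have eqv i n : h i n != 0 ->
      rmon b B' n <= rmon a B n + \sum_j (B' j - B j) * dmon j a B n.
    move=> hn; rewrite leNgt; apply/negP => lt; apply: neq; exists i.
    exact: (rfix_tangent_lt h0 a_ge0 (ltW ab) BB' fB fB' jJ hn lt).
  have B_ge0 i : 0 <= B i by apply: ltW.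
  have B'_ge0 i : 0 <= B' i by apply: ltW.
  have zf i n : h i n != 0 -> n.1 = 0%N.
    move=> hn; apply/eqP; rewrite -leqn0 leqNgt; apply/negP => n1.
    have := le_trans (eqv i n hn) (rmon_tangent a_ge0 B_ge0 BB' n).
    apply/negP; rewrite -ltNge ltr_pM2r; last by apply: prodr_gt0 => k _; apply: exprn_gt0.
    by rewrite ltrXn2r// -lt0n.
  have lin i n : h i n != 0 -> (\sum_l n.2 l <= 1)%N.
    move=> hn; rewrite leqNgt; apply/negP => n2.
    have [lt _] := rmon_strict a_ge0 B_ge0 BB' a0 ltB n2.
    have := le_lt_trans (eqv i n hn) lt; apply/negP; rewrite -leNgt.
    by apply: rmon_le => //; apply: ltW.
  apply: half; apply: rjac_uniq jJ _.
  apply: rjac_free => // k l; apply: has_nsum_ext (jN k l) => n; rewrite /rdterm.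
  have [->|hn] := eqVneq (h k n) 0; first by rewrite !mul0r.
  by rewrite (@dmon_lin _ _ l 0 U B n (lin k n hn)).
pose u j := v j - mxact J v j.
have u_ge0 j' : 0 <= u j' by rewrite subr_ge0 Jv.
have ui : 0 < u i by rewrite subr_gt0.
have [k hk] := irreducible_sum_pos J0 (rjac_edge_gt0 a0 B0 jJ) conn u_ge0 ui.
(* Averaging v spreads the defect u: w - J w is the sum of the J^l u, positive everywhere. *)
pose w j := \sum_(l < k) iter l (mxact J) v j.
have Jw l : mxact J w l = \sum_(l' < k) iter l'.+1 (mxact J) v l.
  rewrite /mxact; under eq_bigr => ? _ do rewrite mulr_sumr.
  by rewrite exchange_big.
have wJ l : w l - mxact J w l = \sum_(l' < k) iter l' (mxact J) u l.
  rewrite Jw -sumrB; apply: eq_bigr => l' _.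
  by rewrite iterSr /u iter_mxactB.
have w_ge0 l : 0 <= w l by rewrite sumr_ge0// => ? _; apply: iter_mxact_ge0.
have Jw_lt l : mxact J w l < w l by rewrite -subr_gt0 wJ.
have w0 l : 0 < w l by apply: le_lt_trans (Jw_lt l); apply: mxact_ge0.
have [q q1 hq] := strict_ratio w0 Jw_lt.
by exists q, w.
Qed.

Section linear.
Hypothesis lin : forall i (n : mindex m), (1 < \sum_j n.2 j)%N -> h i n = 0.

Let rdterm_lin i j x B C n : rdterm h i j x B n = rdterm h i j x C n.
Proof.
rewrite /rdterm; have [n1|n1] := leqP (\sum_j n.2 j) 1.
  by rewrite (@dmon_lin _ _ j x B C n n1).
by rewrite lin// !mul0r.
Qed.

Let rterm_lin i x B C n : 0 <= x -> (forall i, 0 <= C i) -> (forall i, C i <= B i) ->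
  rterm h i x B n = rterm h i x C n + h i n * \sum_j (B j - C j) * dmon j x B n.
Proof.
move=> x0 C0 CB; rewrite /rterm; have [n1|n1] := leqP (\sum_j n.2 j) 1.
  by rewrite -mulrDr -rmon_lin.
by rewrite lin// !mul0r addr0.
Qed.

(** H is affine in Y, so d = B - C satisfies J d = d. For a > 0 let c C touch d from above: u = c C
    - d satisfies u = c s + J u, where s = H(a, 0), and vanishes somewhere, so irreducibility gives
    u = 0 and s = 0. Then 0 is a fixed point, against 0 < Y(a) <= 0. *)
Lemma linear_rfix_gsum a B : 0 <= a -> rfix a B -> gsum a B.
Proof.
move=> a_ge0 fB.
have [C [gC CB]] := rfix_gsum h0 cy a_ge0 fB.
have fC := gfix a_ge0 gC; have C_ge0 := rfix_ge0 fC; have B_ge0 := rfix_ge0 fB.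
suff BC i : B i - C i <= 0.
  suff <- : C = B by [].
  by apply/funext => i; apply/eqP; rewrite eq_le CB -subr_le0 BC.
have d_ge0 k : 0 <= B k - C k by rewrite subr_ge0.
have [J jJ] : exists J, rjac a B J.
  move: (a_ge0); rewrite le_eqVlt => /predU1P[<-|a0].
    by exists N => k l; apply: has_nsum_ext (jN k l) => n; apply: rdterm_lin.
  have C0 := gsum_gt0 a0 gC.
  (* By linearity the derivative in Y_l times C l is part of H_k(a, C) = C k. *)
  apply: (@rjac_of_bound _ _ _ _ _ (fun k l => (C l)^-1 * C k)) => k l G.
  rewrite mulrC ler_pdivlMr// mulrC -psumZ.
  apply: le_trans ((fC k).1 G); apply: psum_le => n.
  rewrite (rdterm_lin k l a B C n).
  rewrite (@rterm_lin k a C (fun=> 0) n)// ler_wpDl ?rterm_ge0//.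
  rewrite mulrCA ler_wpM2l// (bigD1 l)//= subr0 lerDl sumr_ge0// => l' _.
  by rewrite subr0 mulr_ge0// dmon_ge0.
have Jd k : mxact J (fun j => B j - C j) k = B k - C k.
  have hs := has_nsum_taylor h0 a_ge0 C_ge0 CB B_ge0 B_ge0 (fC k) jJ.
  have : has_nsum (rterm h k a B) (C k + mxact J (fun j => B j - C j) k).
    by apply: has_nsum_ext hs => n; rewrite -rterm_lin.
  by move=> /(has_nsum_uniq (fB k)); lra.
have J0 := rjac_ge0 jJ.
move: (a_ge0); rewrite le_eqVlt => /predU1P[a0|a0].
  have [w w0 Nw] := nilpotent_w.
  apply: (@subinvariant_le0 _ _ J w (fun j => B j - C j)) => // k; last by rewrite Jd.
  have -> : J = N.
    apply: rjac_uniq jJ _; rewrite -a0 => k' l.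
    by apply: has_nsum_ext (jN k' l) => n; apply: rdterm_lin.
  by apply: le_lt_trans (Nw k) _; have := w0 k; lra.
rewrite leNgt; apply/negP => di.
have C0 := gsum_gt0 a0 gC.
have B0 k : 0 < B k by apply: lt_le_trans (CB k).
have [c [j [c0 dj dk]]] := max_ratio (d := fun k => B k - C k) C0 di.
have /choice[s hs] k : exists s, has_nsum (rterm h k a (fun=> 0)) s.
  by apply: (has_nsum_dom _ (fC k)) => n; apply: rterm_le.
have s_ge0 k : 0 <= s k by apply: has_nsum_ge0 (hs k).
have jC : rjac a C J.
  by move=> k l; apply: has_nsum_ext (jJ k l) => n; apply: rdterm_lin.
have Cs k : C k = s k + mxact J C k.
  have z0 (l : 'I_m) : 0 <= (0 : R) by [].
  have ht := has_nsum_taylor h0 a_ge0 z0 C_ge0 C_ge0 C_ge0 (hs k) jC.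
  have E : (fun j : 'I_m => C j - 0) = C by apply/funext => l; rewrite subr0.
  rewrite E in ht; apply: has_nsum_uniq (fC k) _.
  by apply: has_nsum_ext ht => n; rewrite -rterm_lin.
pose u k := c * C k - (B k - C k).
have u_ge0 k : 0 <= u k by rewrite subr_ge0.
have uE k : u k = c * s k + mxact J u k.
  by rewrite /u mxactB mxactZ Jd; have := Cs k; set X := mxact J C k => ->; ring.
have uj : u j = 0 by rewrite /u dj subrr.
have u0 k : u k = 0.
  apply/eqP; rewrite eq_le u_ge0 andbT leNgt; apply/negP => uk.
  suff : 0 < u j by rewrite uj ltxx.
  apply: (irreducible_pos J0 (rjac_edge_gt0 a0 B0 jJ) conn u_ge0 uk) => l.
  by rewrite [leRHS]uE lerDr mulr_ge0// ltW.
have s0 k : s k = 0.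
  have := uE k; rewrite u0 => /esym/eqP; rewrite paddr_eq0 ?mxact_ge0//; last first.
    by rewrite mulr_ge0// ltW.
  by rewrite mulf_eq0 gt_eqF//= => /andP[/eqP].
have f0 : rfix a (fun=> 0) by move=> k; have := hs k; rewrite s0.
have [V [gV V0]] := rfix_gsum h0 cy a_ge0 f0.
by have := lt_le_trans (gsum_gt0 a0 gV i) (V0 i); rewrite ltxx.
Qed.

End linear.

Lemma unit_rfix_gsum a B J : 0 <= a -> rfix a B -> rjac a B J ->
  (forall t, 1 < t -> t%:M - J \in unitmx) -> gsum a B.
Proof.
move=> a_ge0 fB jJ uJ.
have [C [gC CB]] := rfix_gsum h0 cy a_ge0 fB.
have fC := gfix a_ge0 gC; have C_ge0 := rfix_ge0 fC; have B_ge0 := rfix_ge0 fB.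
have [lin|nlin] := pselect (forall i (n : mindex m), (1 < \sum_j n.2 j)%N -> h i n = 0).
  exact: linear_rfix_gsum.
suff BC i : B i - C i <= 0.
  suff <- : C = B by [].
  by apply/funext => i; apply/eqP; rewrite eq_le CB -subr_le0 BC.
have J0 := rjac_ge0 jJ.
pose d k := B k - C k.
have d_ge0 k : 0 <= d k by rewrite subr_ge0.
move: (a_ge0); rewrite le_eqVlt => /predU1P[a0|a0].
  have CU : C = U by apply: gsum_at0; rewrite a0.
  have jC : rjac a C N by rewrite CU -a0.
  have N0 := rjac_ge0 jC.
  have Nd k : mxact N d k <= d k := rfix_tangent h0 a_ge0 (lexx a) CB fC fB jC k.
  have Nkd k l : iter k (mxact N) d l <= d l.
    elim: k l => //= k IH l; apply: le_trans (Nd l).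
    by apply: mxact_le.
  have NJ := rjac_le h0 a_ge0 (lexx a) C_ge0 CB jC jJ.
  (* Rests on the trapezoid bound 2 d <= N d + J d. At k = K the power of [N] vanishes and J^K d >=
     2 d; the bound d <= J d alone would give no growth. *)
  have grow k l : 2%:R * d l - iter k (mxact N) d l <= iter k (mxact J) d l.
    elim: k l => [|k IH] l /=; first lra.
    apply: le_trans (mxact_le J0 IH l).
    have h1 : 2%:R * d l <= mxact N d l + mxact J d l.
      exact: (rfix_trapezoid h0 a_ge0 CB fC fB jC jJ l).
    have h2 : mxact N (fun j => d j - iter k (mxact N) d j) l <=
       mxact J (fun j => d j - iter k (mxact N) d j) l.
      by apply: mxact_leM => // j; rewrite subr_ge0.
    rewrite (mxactB J (fun j => 2%:R * d j)) mxactZ.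
    by rewrite (mxactB N d) (mxactB J d) in h2; lra.
  apply: (@unit_above1_no_growth _ _ J d K 2%:R J0 uJ); first lra.
  move=> l; have := grow K l; rewrite iter_mxactE NK /mxact big1 ?subr0// => j _.
  by rewrite mxE mul0r.
rewrite leNgt; apply/negP => di.
have C0 := gsum_gt0 a0 gC.
have B0 k : 0 < B k by apply: lt_le_trans (CB k).
have dJ k : d k <= mxact J d k := rfix_upper h0 a_ge0 CB fC fB jJ k.
have J_edge := rjac_edge_gt0 a0 B0 jJ.
have [[j jlt]|neq] := pselect (exists j, d j < mxact J d j).
  pose u k := mxact J d k - d k.
  have u_ge0 k : 0 <= u k by rewrite subr_ge0.
  have uj : 0 < u j by rewrite subr_gt0.
  have [k hk] := irreducible_sum_pos J0 J_edge conn u_ge0 uj.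
  (* J^k d equals d plus the sum of the J^p u, and that sum is at least d / c: growth by the factor
     1 + 1/c. *)
  have [c [l [c0 _ dc]]] := max_ratio (d := d) hk di.
  suff : d i <= 0 by rewrite leNgt di.
  apply: (@unit_above1_no_growth _ _ J d k (1 + c^-1) J0 uJ).
    by rewrite ltrDl invr_gt0.
  move=> l'.
  have -> : iter k (mxact J) d l' = d l' + \sum_(p < k) iter p (mxact J) u l'.
    have := iter_telescope J d k l'.
    have -> : \sum_(p < k) iter p (mxact J) (fun j => d j - mxact J d j) l' =
       - \sum_(p < k) iter p (mxact J) u l'.
      rewrite -sumrN; apply: eq_bigr => p _.
      by rewrite !iter_mxactB opprB.
    lra.
  by rewrite mulrDl mul1r lerD2l ler_pdivrMl.
have Jd k : mxact J d k <= d k.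
  by rewrite leNgt; apply/negP => lt; apply: neq; exists k.
have d0 := irreducible_pos J0 J_edge conn d_ge0 di Jd.
(* Now J d = d with d positive everywhere, and a monomial of degree at least 2 in Y would make the
   upper bound strict. *)
apply: nlin => k n n2; apply/eqP; apply: contraT => hn.
have ltCB l : C l < B l by rewrite -subr_gt0; apply: d0.
have [_ lt] := rmon_strict a_ge0 C_ge0 CB a0 ltCB n2.
exfalso; apply: neq; exists k.
exact: (rfix_upper_lt h0 a_ge0 CB fC fB jJ hn lt).
Qed.

End irreducible_real_system.

(** * Complex systems *)

Local Open Scope complex_scope.

Section complex_sums.
Variables (R : realType) (I : choiceType).
Implicit Types (f : I -> R) (z : R[i]).

Lemma norm_cmodulus z : `|z| = (cmodulus z)%:C.
Proof. by rewrite /cmodulus normc_def. Qed.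

Lemma cmodulus_ge0 z : 0 <= cmodulus z.
Proof. by rewrite -lecR -norm_cmodulus; exact: normr_ge0. Qed.

Lemma cmodulusM z w : cmodulus (z * w) = cmodulus z * cmodulus w.
Proof. by apply: complexI; rewrite rmorphM /= -!norm_cmodulus normrM. Qed.

Lemma cmodulus_eq0 z : (cmodulus z == 0) = (z == 0).
Proof. by rewrite -(inj_eq (@complexI R)) -norm_cmodulus normr_eq0. Qed.

Lemma cmodulus_real (r : R) : cmodulus r%:C = `|r|.
Proof. by rewrite /cmodulus normc_def /= expr0n addr0 sqrtr_sqr. Qed.

Lemma cmodulus_sum (J : Type) (r : seq J) (F : J -> R[i]) :
  cmodulus (\sum_(j <- r) F j) <= \sum_(j <- r) cmodulus (F j).
Proof.
rewrite -lecR -norm_cmodulus rmorph_sum /=.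
apply: (le_trans (ler_norm_sum _ _ _)).
by rewrite (eq_bigr (fun j => (cmodulus (F j))%:C))// => j _; rewrite norm_cmodulus.
Qed.

Lemma ge0_complexE z : 0 <= z -> z = (complex.Re z)%:C.
Proof. by case: z => x y; rewrite lecE /= => /andP[/eqP -> _]. Qed.

Lemma abs_summable_nsum f : (forall n, 0 <= f n) ->
  abs_summable (fun n => (f n)%:C) <-> exists s, has_nsum f s.
Proof.
move=> f0; rewrite /abs_summable /summable.
have -> : (fun n => `|(cmodulus (f n)%:C)%:E|%E) = (fun n => (f n)%:E).
  by apply/funext => n; rewrite cmodulus_real !ger0_norm//= ger0_norm.
split=> [fin|[s [fs _]]].
  have fn : esum setT (fun n => (f n)%:E) \is a fin_num.
    by rewrite ge0_fin_numE// esum_ge0// => n _; rewrite lee_fin.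
  apply: (@has_nsum_ex _ _ _ (fine (esum setT (fun n => (f n)%:E)))) => F.
  rewrite -lee_fin fineK// /psum -sumEFin.
  apply: esum_ge; exists [set` F]; first by split.
  by rewrite fsbig_finite//= set_fsetK.
apply: (@le_lt_trans _ _ s%:E); last exact: ltry.
apply: ge_ereal_sup => _ [A [finA _] <-].
by rewrite fsbig_finite// sumEFin lee_fin; apply: fs.
Qed.

Lemma csum_nsum f s : (forall n, 0 <= f n) -> has_nsum f s ->
  csum (fun n => (f n)%:C) = s%:C.
Proof.
move=> f0 hs; rewrite /csum /summability.sum.
have FF : ProperFilter (@summability.totally I) by exact: summability.totally_filter.
have hC : hausdorff_space (R[i])^o by exact: norm_hausdorff.
apply: (cvg_lim hC).
apply/cvgrPdist_lt => d d0.
have dE := ge0_complexE (ltW d0); rewrite dE ltcR in d0 *.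
have [G hG] := has_nsum_approx hs d0.
exists G => // F /= GF.
have -> : summability.partial_sum (fun n => (f n)%:C : (R[i])^o) F = (psum f F)%:C.
  by rewrite /summability.partial_sum /psum big_seq_fsetE rmorph_sum.
rewrite -[X in `|X|]/(s%:C - (psum f F)%:C) -rmorphB /= norm_cmodulus cmodulus_real.
rewrite ltcR ltr_distl.
have := hs.1 F; have := psum_sub f0 GF; lra.
Qed.

End complex_sums.

Section spectrum.
Variables (R : realType) (m : nat).
Implicit Types (A : 'M[R]_m) (q : R).

(** Eigenvectors are row vectors here: the moduli z of the entries satisfy |l| z <= z A, and pairing
    with w gives |l| (z w) <= z A w <= q (z w) with z w > 0. *)
Lemma eigenvalue_bound A w q (l : R[i]) : nonneg_mx A -> (forall i, 0 < w i) ->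
  (forall i, mxact A w i <= q * w i) ->
  eigenvalue (map_mx (real_complex R) A) l -> cmodulus l <= q.
Proof.
move=> A0 w0 Aw /eigenvalueP[u uA un0].
pose z i := cmodulus (u 0 i).
have z0 i : 0 <= z i by apply: cmodulus_ge0.
have lz j : cmodulus l * z j <= \sum_i z i * A i j.
  have := congr1 (fun M : 'rV_m => M 0 j) uA; rewrite !mxE => E.
  rewrite /z -cmodulusM -E.
  apply: (le_trans (cmodulus_sum _ _)); apply: ler_sum => i _.
  by rewrite mxE cmodulusM cmodulus_real ger0_norm.
have S0 : 0 < \sum_j z j * w j.
  have /rV0Pn[j uj] := un0.
  rewrite (bigD1 j)//= ltr_pwDl//; last by rewrite sumr_ge0// => k _; rewrite mulr_ge0// ltW.
  by rewrite mulr_gt0// lt_def z0 cmodulus_eq0 uj.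
rewrite -(ler_pM2r S0) !mulr_sumr.
apply: (@le_trans _ _ (\sum_j \sum_i z i * A i j * w j)).
  by apply: ler_sum => j _; rewrite mulrA -mulr_suml ler_wpM2r// ltW.
rewrite exchange_big; apply: ler_sum => i _ /=.
under eq_bigr => j _ do rewrite -mulrA.
by rewrite -mulr_sumr [leRHS]mulrCA; apply: ler_wpM2l => //; apply: Aw.
Qed.

(** [0 <= q] covers an empty set of eigenvalues, whose [sup] is 0. *)
Lemma spectral_radius_le A w q : nonneg_mx A -> 0 <= q -> (forall i, 0 < w i) ->
  (forall i, mxact A w i <= q * w i) ->
  spectral_radius (map_mx (real_complex R) A) <= q.
Proof.
move=> A0 q0 w0 Aw; rewrite /spectral_radius.
set E := (X in sup X); have [->|/set0P En0] := eqVneq E set0; first by rewrite sup0.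
by apply: ge_sup => // _ [l le <-]; apply: eigenvalue_bound Aw le.
Qed.

Lemma spectral_radius_unit A : nonneg_mx A ->
  spectral_radius (map_mx (real_complex R) A) <= 1 ->
  forall t, 1 < t -> t%:M - A \in unitmx.
Proof.
move=> A0 s1 t t1; apply/negPn/negP => nu.
have et : eigenvalue A t.
  rewrite /eigenvalue /eigenspace kermx_eq0 row_free_unit.
  by apply: contra nu => u; rewrite -opprB -scaleN1r unitmxZ// unitrN1.
rewrite -(eigenvalue_map (real_complex R)) in et.
suff : cmodulus t%:C <= 1 by rewrite cmodulus_real ger0_norm; lra.
apply: le_trans s1; apply: ub_le_sup; last by exists t%:C.
(* [sup] is an upper bound only for a bounded set; the row sums bound all eigenvalues. *)
have [M M0 hM] := entry_bound (fun i => \sum_j A i j).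
exists M => _ [l le <-].
apply: (@eigenvalue_bound A (fun=> 1) M l) => // i.
rewrite mulr1 /mxact; under eq_bigr => j _ do rewrite mulr1.
exact: le_trans (ler_norm _) (hM i).
Qed.

End spectrum.

Section complex_systems.
Variables (R : realType) (m : nat).
Implicit Types (H : system R m) (Y : gf R m) (x : R) (V : 'I_m -> R).

Definition cpt x V : Defs.cpoint R m := (x%:C, \row_i (V i)%:C).

Section coefficients.
Variable h : 'I_m -> mindex m -> R.
Hypothesis h0 : forall i n, 0 <= h i n.
Let H : system R m := fun i n => (h i n)%:C.

Lemma ps_monomialE x V n : ps_monomial (cpt x V) n = (rmon x V n)%:C.
Proof.
rewrite /ps_monomial /rmon rmorphM rmorphXn /= rmorph_prod; congr (_ * _).
by apply: eq_bigr => j _; rewrite mxE rmorphXn.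
Qed.

Lemma ps_termE i x V :
  ps_term (H i) (cpt x V) = (fun n => (rterm h i x V n)%:C).
Proof. by apply/funext => n; rewrite /ps_term ps_monomialE -rmorphM. Qed.

Definition msucc (j : 'I_m) (n : mindex m) : mindex m :=
  (n.1, [ffun l => (n.2 l + (l == j))%N]).

Lemma msuccK j : cancel (msucc j) (mpred j).
Proof.
by case=> n k; congr (_, _); apply/ffunP => l; rewrite !ffunE /= ?ffunE addnK.
Qed.

Lemma mpredK j (n : mindex m) : (0 < n.2 j)%N -> msucc j (mpred j n) = n.
Proof.
case: n => n k /= kj; congr (_, _); apply/ffunP => l; rewrite !ffunE /= ?ffunE.
by case: eqP => [->|_]; rewrite ?subn0 ?addn0// subnK.
Qed.

Lemma ps_dY_termE i j x V : ps_term (ps_dY j (H i)) (cpt x V) =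
  (fun n => ((rdterm h i j x V \o msucc j) n)%:C).
Proof.
apply/funext => n; rewrite /= /rdterm /dmon msuccK /ps_term ps_monomialE /ps_dY.
by rewrite /msucc /= ffunE eqxx addn1 !rmorphM rmorph_nat [RHS]mulrCA mulrA.
Qed.

Lemma rdterm_reindex i j x V s : 0 <= x -> (forall i, 0 <= V i) ->
  has_nsum (rdterm h i j x V) s <-> has_nsum (rdterm h i j x V \o msucc j) s.
Proof.
move=> x0 V0; apply: has_nsum_reindex.
- exact: can_inj (@msuccK j).
- by move=> n; apply: rdterm_ge0.
move=> n nz; exists (mpred j n); rewrite mpredK// lt0n.
by apply: contra nz => /eqP nj; rewrite /rdterm /dmon nj mul0r mulr0.
Qed.

Lemma abs_summable_rterm i x V : 0 <= x -> (forall i, 0 <= V i) ->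
  abs_summable (ps_term (H i) (cpt x V)) <-> exists s, has_nsum (rterm h i x V) s.
Proof.
by move=> x0 V0; rewrite ps_termE; apply: abs_summable_nsum => n; apply: rterm_ge0.
Qed.

Lemma csum_rterm i x V s : 0 <= x -> (forall i, 0 <= V i) ->
  has_nsum (rterm h i x V) s -> csum (ps_term (H i) (cpt x V)) = s%:C.
Proof.
by move=> x0 V0; rewrite ps_termE; apply: csum_nsum => n; apply: rterm_ge0.
Qed.

Lemma abs_summable_rdterm x V : 0 <= x -> (forall i, 0 <= V i) ->
  (forall i j, abs_summable (ps_term (ps_dY j (H i)) (cpt x V))) <->
  exists J, rjac h x V J.
Proof.
move=> x0 V0; split=> [sm|[J jJ] i j].
  have /choice[s hs] (ij : 'I_m * 'I_m) : exists s, has_nsum (rdterm h ij.1 ij.2 x V) s.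
    have := sm ij.1 ij.2; rewrite ps_dY_termE => /abs_summable_nsum[].
      by move=> n; apply: rdterm_ge0.
    by move=> s /rdterm_reindex hs; exists s; apply: hs.
  by exists (\matrix_(i, j) s (i, j)) => i j; rewrite mxE; exact: (hs (i, j)).
rewrite ps_dY_termE; apply/abs_summable_nsum; first by move=> n; apply: rdterm_ge0.
by exists (J i j); apply/rdterm_reindex.
Qed.

Lemma jacobianE x V J : 0 <= x -> (forall i, 0 <= V i) -> rjac h x V J ->
  Defs.jacobian H (cpt x V) = map_mx (real_complex R) J.
Proof.
move=> x0 V0 jJ; apply/matrixP => i j; rewrite !mxE ps_dY_termE.
apply: csum_nsum; first by move=> n; apply: rdterm_ge0.
by apply/rdterm_reindex.
Qed.

Lemma nbhs_complex_real (P : set (R[i])^o) (z : R) : nbhs (z%:C : (R[i])^o) P ->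
  exists2 d, 0 < d & forall r, `|z - r| < d -> P r%:C.
Proof.
move=> /nbhs_ballP[d /= d0 dP].
have dE := ge0_complexE (ltW d0).
exists (complex.Re d); first by rewrite -ltcR -dE.
move=> r zr; apply: dP; rewrite -ball_normE /ball_ /=.
rewrite -[X in `|X|]/(z%:C - r%:C) -rmorphB /= norm_cmodulus cmodulus_real dE.
by rewrite ltcR.
Qed.

(** In the interior every Y_j can be increased a little with z unchanged, and [rjac_below]
    applies. *)
Lemma domain_rjac x V : 0 <= x -> (forall i, 0 <= V i) ->
  domain_of_convergence H (cpt x V) -> exists J, rjac h x V J.
Proof.
move=> x0 V0 [[P Q] /= [nP [Q' nQ' QQ'] PQ]].
have /choice[d hd] (j : 'I_m) : exists d, 0 < d /\ forall r, `|V j - r| < d -> Q' 0 j r%:C.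
  have := nQ' 0 j; rewrite mxE => /nbhs_complex_real[d d0 dQ].
  by exists d.
pose V' j := V j + d j / 2%:R.
have VV' j : V j < V' j by have [d0 _] := hd j; rewrite /V'; lra.
have V'0 j : 0 <= V' j by apply: le_trans (V0 j) (ltW (VV' j)).
have sm i : exists s, has_nsum (rterm h i x V') s.
  apply/abs_summable_rterm => //; apply: (PQ (cpt x V')); split => /=.
    exact: nbhs_singleton nP.
  apply: QQ' => k j; rewrite ord1 mxE; have [d0] := hd j; apply.
  rewrite /V' opprD addrA subrr add0r normrN ger0_norm; lra.
have [s hs] := choice sm.
exact: (rjac_below h0 x0 (lexx x) V0 VV' hs).
Qed.

End coefficients.

Lemma gf_termE (y : 'I_m -> nat -> R) x i :
  gf_term (fun i k => (y i k)%:C) x%:C i = (fun k => (y i k * x ^+ k)%:C).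
Proof. by apply/funext => k; rewrite /gf_term rmorphM rmorphXn. Qed.

Section generating_function.
Variable y : 'I_m -> nat -> R.
Hypothesis y0 : forall i k, 0 <= y i k.
Let Y : gf R m := fun i k => (y i k)%:C.

Let term_ge0 x i k : 0 <= x -> 0 <= y i k * x ^+ k.
Proof. by move=> x0; rewrite mulr_ge0// exprn_ge0. Qed.

Lemma abs_summable_gsum x : 0 <= x ->
  (forall i, abs_summable (gf_term Y x%:C i)) <-> exists V, gsum y x V.
Proof.
move=> x0; split=> [sm|[V gV] i].
  have /choice[V hV] i : exists s, has_nsum (fun k => y i k * x ^+ k) s.
    by have := sm i; rewrite gf_termE => /abs_summable_nsum; apply => k; apply: term_ge0.
  by exists V.
by rewrite gf_termE; apply/abs_summable_nsum => [k|]; [apply: term_ge0|exists (V i)].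
Qed.

Lemma gf_evalE x V : 0 <= x -> gsum y x V -> gf_eval Y x%:C = \row_i (V i)%:C.
Proof.
move=> x0 gV; apply/rowP => i; rewrite !mxE gf_termE.
by apply: csum_nsum => // k; apply: term_ge0.
Qed.

(** At the radius of convergence the value is a left limit, which equals the sum of the series as
    soon as that converges. Positivity of the radius ensures a > 0 in this case. *)
Lemma gf_valueE a V (B : 'rV[R]_m) : 0 <= a -> gsum y a V -> (0 < gf_radius Y)%E ->
  (a%:E <= gf_radius Y)%E -> gf_value Y a B <-> V = B 0.
Proof.
move=> a_ge0 gV r0 ar; rewrite /gf_value.
case: ifPn => [_|]; last rewrite -leNgt => ra.
  rewrite (gf_evalE a_ge0 gV); split=> [VB|-> i]; last by rewrite mxE.
  by apply/funext => i; apply: complexI; rewrite -VB mxE.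
have a0 : 0 < a by rewrite -lte_fin; apply: lt_le_trans ra.
have [W gW] := gsum_family y0 a_ge0 gV.
have cW i : complex.Re (gf_eval Y x%:C 0 i) @[x --> a^'-] --> V i.
  apply: cvg_trans (gsum_left y0 a0 gV gW (i := i)).
  apply: near_eq_cvg; near=> x.
  have xa : x < a by near: x; apply: nbhs_left_lt.
  have x0 : 0 < x by near: x; apply: nbhs_left_gt.
  by rewrite (gf_evalE (ltW x0) (gW x (ltW x0) (ltW xa))) mxE.
split=> [cB|<- //]; apply/funext => i.
exact: (cvg_unique _ (cW i) (cB i)).
Unshelve. all: by end_near.
Qed.

End generating_function.
End complex_systems.

Theorem theorem3p8 (R : realType) (m : nat) (H : system R m) (Y : gf R m)
    (a : R) (B : 'rV[R]_m)
    (H_analytic : domain_of_convergence H 0)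
    (H_irreducible : irreducible_system H)
    (Y_solution : gf_solution H Y)
    (a_ge0 : 0 <= a) (B_ge0 : forall i, 0 <= B 0 i)
    (aB_domain : closure (domain_of_convergence H) (real_point a B))
    (aB_fixed : fixed_at H a B) :
  (0 < gf_radius Y)%E /\
  (linear_in_Y H -> (a%:E <= gf_radius Y)%E /\ gf_value Y a B) /\
  ((Lambda H a B <= 1)%E <-> (a%:E <= gf_radius Y)%E /\ gf_value Y a B) /\
  (Lambda H a B = 1%E -> a%:E = gf_radius Y /\ gf_value Y a B).
Proof.
have [[H_ge0 H_dom [K H_nil]] H_zf _ H_conn] := H_irreducible.
have Y_nz := H_zf _ Y_solution.
have [Y_ge0 Y_at0 Y_near] := Y_solution.
pose h i n := complex.Re (H i n); pose y i k := complex.Re (Y i k).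
have Hh i n : H i n = (h i n)%:C := ge0_complexE (H_ge0 i n).
have Yy i k : Y i k = (y i k)%:C := ge0_complexE (Y_ge0 i k).
have HE : H = (fun i n => (h i n)%:C) by apply/funext => i; apply/funext.
have YE : Y = (fun i k => (y i k)%:C) by apply/funext => i; apply/funext.
have h0 i n : 0 <= h i n by rewrite -lecR -Hh; exact: H_ge0.
have y0 i k : 0 <= y i k by rewrite -lecR -Yy; exact: Y_ge0.
have y_nz i : exists k, y i k != 0.
  by have [k Yk] := Y_nz i; exists k; rewrite -(inj_eq (@complexI R)) -Yy.
pose U i := y i 0%N.
have UE : (0, Uiter H m) = cpt 0 U.
  congr (_, _); apply/rowP => i; rewrite mxE -Y_at0.
  exact: Yy.
have U0 i : 0 <= U i by exact: y0.
have [N jN] : exists N, rjac h 0 U N.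
  apply: domain_rjac => //; rewrite -HE -UE; exact: H_dom.
have NK : N ^+ K = 0.
  apply/eqP; rewrite -(map_mx_eq0 (real_complex R)); apply/eqP.
  rewrite -[RHS]H_nil UE HE (jacobianE h0 (lexx 0) U0 jN).
  elim: K {H_nil} => [|k IH]; first by rewrite !expr0 map_mx1.
  by rewrite !exprS map_mxM IH.
have [x0 x00 near0] : exists2 x0 : R, 0 < x0 & forall x, 0 <= x -> x <= x0 ->
    [/\ forall i, abs_summable (gf_term Y x%:C i),
        domain_of_convergence H (x%:C, gf_eval Y x%:C)
      & gf_eval Y x%:C = sys_eval H (x%:C, gf_eval Y x%:C)].
  have [d d0 dP] := @nbhs_complex_real R _ 0 Y_near.
  exists (d / 2%:R); first lra.
  by move=> x xge0 xd; apply: dP; rewrite sub0r normrN ger0_norm; lra.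
have fixV x V : 0 <= x -> x <= x0 -> gsum y x V -> rfix h x V.
  move=> xge0 xx0 gV; have [_ dom eqn] := near0 x xge0 xx0.
  have V0 i : 0 <= V i by apply: has_nsum_ge0 (gV i).
  rewrite YE (gf_evalE y0 xge0 gV) -/(cpt x V) in dom eqn.
  move=> i; have := interior_subset dom i.
  rewrite HE => /(abs_summable_rterm h0 i xge0 V0)[s hs].
  suff -> : V i = s by [].
  apply: complexI; have := congr1 (fun M : 'rV_m => M 0 i) eqn; rewrite !mxE => ->.
  by rewrite HE; apply: csum_rterm.
have [V0 gV0] : exists V, gsum y x0 V.
  apply/abs_summable_gsum => //; first exact: ltW.
  by rewrite -YE; have [] := near0 x0 (ltW x00) (lexx _).
have [J0 jJ0] : exists J, rjac h x0 V0 J.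
  apply: domain_rjac => //; [exact: ltW|by move=> i; apply: has_nsum_ge0 (gV0 i)|].
  have [_ dom _] := near0 x0 (ltW x00) (lexx _).
  by rewrite -HE; rewrite YE (gf_evalE y0 (ltW x00) gV0) in dom.
have cy := approx_coefs_cvg_of_nilpotent h0 y0 x00 fixV gV0 jJ0 jN NK.
pose e := [rel u v | `[< depends H u v >]].
have eP i j : e i j -> exists n : mindex m, (0 < n.2 j)%N /\ h i n != 0.
  move=> /asboolP[n [nj Hn]]; exists n; split => //.
  by rewrite -(inj_eq (@complexI R)) -Hh.
have in_radius x V : 0 <= x -> gsum y x V -> (x%:E <= gf_radius Y)%E.
  move=> xge0 gV; apply: ereal_sup_ubound; exists x => //; split => //.
  by rewrite YE; apply/abs_summable_gsum => //; exists V.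
have r0 : (0 < gf_radius Y)%E.
  by apply: lt_le_trans (in_radius _ _ (ltW x00) gV0); rewrite lte_fin.
have ptE : real_point a B = cpt a (B 0) by [].
have fB : rfix h a (B 0).
  move=> i; have [] := aB_fixed i; rewrite ptE {1}HE.
  move=> /(abs_summable_rterm h0 i a_ge0 B_ge0)[s hs].
  by rewrite mxE HE (csum_rterm h0 a_ge0 B_ge0 hs) => /complexI <-.
have [V [gV VB]] := rfix_gsum h0 cy a_ge0 fB.
have ar := in_radius _ _ a_ge0 gV.
(* Since Y(a) converges at every fixed point, all conclusions about radius and value reduce to one
   statement on real sums. *)
have valE : (a%:E <= gf_radius Y)%E /\ gf_value Y a B <-> gsum y a (B 0).
  have E := @gf_valueE R m y y0 a V B a_ge0 gV; rewrite -YE in E.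
  split=> [[_ /(E r0 ar) <-//]|gB]; split => //.
  by apply/(E r0 ar); apply: gsum_uniq gV gB.
have LE J : rjac h a (B 0) J ->
    Lambda H a B = (spectral_radius (map_mx (real_complex R) J))%:E.
  move=> jJ; rewrite /Lambda ptE ifT.
    by rewrite [in LHS]HE (jacobianE h0 a_ge0 B_ge0 jJ).
  by apply/asboolP; rewrite HE; apply/abs_summable_rdterm => //; exists J.
have L1 : (Lambda H a B <= 1)%E -> gsum y a (B 0).
  (* A divergent entry would make [Lambda] infinite. *)
  move=> L; have [J jJ] : exists J, rjac h a (B 0) J.
    move: L; rewrite /Lambda ptE; case: asboolP => // + _.
    by rewrite {1}HE => /abs_summable_rdterm; apply.
  move: L; rewrite (LE J jJ) lee_fin => L.
  apply: (unit_rfix_gsum h0 y0 y_nz cy jN NK eP H_conn a_ge0 fB jJ).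
  exact: spectral_radius_unit (rjac_ge0 jJ) L.
split=> //; split; last split.
- move=> lin; apply/valE.
  apply: (linear_rfix_gsum h0 y0 y_nz cy jN NK eP H_conn) => // i n n1.
  by apply: complexI; rewrite -Hh lin.
- split=> [/L1/valE//|/valE gB].
  have [J jJ supJ] := gsum_superinvariant h0 y0 y_nz cy jN NK eP H_conn a_ge0 gB.
  rewrite (LE J jJ) lee_fin; apply/ler_addgt0Pr => d d0.
  have [|w w0 Jw] := supJ (1 + d); first lra.
  by apply: (spectral_radius_le (rjac_ge0 jJ) _ w0 Jw); lra.
move=> L; have gB : gsum y a (B 0) by apply: L1; rewrite L.
split; last by have /valE[] := gB.
(* If a were below the radius, Y would converge at some b > a and the Jacobian at a would contract a
   positive vector, giving [Lambda] < 1. *)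
apply/eqP; rewrite eq_le ar /= leNgt; apply/negP => /ereal_sup_gt[_ [b [b0 sb] <-]].
rewrite lte_fin => ab.
have [B' gB'] : exists B', gsum y b B' by apply/abs_summable_gsum => //; rewrite -YE.
have [J jJ _] := gsum_superinvariant h0 y0 y_nz cy jN NK eP H_conn a_ge0 gB.
have [q [w [q1 w0 Jw]]] :=
  gsum_interior_contracted h0 y0 y_nz cy jN NK eP H_conn a_ge0 ab gB gB' jJ.
have q'0 : 0 <= Num.max q 0 by rewrite le_max lexx orbT.
have := @spectral_radius_le _ _ _ w (Num.max q 0) (rjac_ge0 jJ) q'0 w0.
move: L; rewrite (LE J jJ) => -[->] /(_ _) le1.
suff : (1 : R) < 1 by rewrite ltxx.
apply: (@le_lt_trans _ _ (Num.max q 0)); last by rewrite gt_max q1 ltr01.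
apply: le1 => i; apply: le_trans (Jw i) _.
by rewrite ler_pM2r// le_max lexx.
Qed.
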